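(* Let $f:\{0,1\}^n\to\{0,1\}$ satisfy $\mathbf{I}(f)\le 6\sqrt{n}$, and let $\varepsilon\in(0,1)$. If $f$ is $\varepsilon$-far from being monotone, then the following algorithm rejects with probability $\Omega\!\left(\frac{\varepsilon^4}{\mathbf{I}(f)\log^9 n}\right)$: (1) choose $k\in\{0,1,\dots,\lceil\log n\rceil\}$ uniformly at random and set $\ell:=2^k$; (2) choose $x\in\{0,1\}^n$ uniformly at random; (3) perform an $\ell$-step random walk $p$ on $H_n$ from $x$, ending at $y$; (4) if $f(x)\neq f(y)$, perform binary search on the vertex sequence of $p$ to find an influential edge $(u,v)$ of $p$, and REJECT if $(u,v)$ is a violating edge; (5) otherwise ACCEPT.
   Context: $H_n$ is the undirected hypercube graph on $\{0,1\}^n$ with edges between points at Hamming distance $1$; a random walk step from a vertex moves to a uniformly random neighbor (flips a uniformly random coordinate). The coordinate-wise partial order is $\prec$; $f$ is monotone if $x\prec y$ implies $f(x)\le f(y)$; $f$ is $\varepsilon$-far from monotone if $|\{x:f(x)\ne g(x)\}|/2^n>\varepsilon$ for every monotone $g$. An edge $(x,y)$ of $H_n$ is influential if $f(x)\neq f(y)$; it is violating if $x\prec y$, $f(x)=1$, $f(y)=0$. The total influence is $\mathbf{I}(f)=n\cdot\Pr[f(x)\neq f(y)]$ for a uniformly random edge $(x,y)$ of $H_n$. Binary search on a walk with vertices $x=z_0,\dots,z_\ell=y$ and $f(z_0)\ne f(z_\ell)$ returns some index $i$ with $f(z_i)\ne f(z_{i+1})$, i.e. an influential edge on $p$. Logarithms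 are base 2. *)

(* Defs.v *)
From HB Require Import structures.
From mathcomp Require Import all_boot all_order all_algebra.
From mathcomp Require Import reals exp.
Set Implicit Arguments. Unset Strict Implicit. Unset Printing Implicit Defensive.
Import Order.TTheory GRing.Theory Num.Theory.
Local Open Scope ring_scope.

Definition cube (n : nat) := {ffun 'I_n -> bool}.

Definition flip n (x : cube n) (i : 'I_n) : cube n :=
  [ffun j => if j == i then ~~ x j else x j].

Definition cube_le n (x y : cube n) : bool := [forall i, x i ==> y i].

Definition monotone n (g : cube n -> bool) : Prop :=
  forall x y, cube_le x y -> (g x <= g y)%N.

Definition fdist (R : realType) n (f g : cube n -> bool) : R :=
  #|[set x : cube n | f x != g x]|%:R / (2 ^ n)%:R.

Definition far_from_monotone (R : realType) n (eps : R) (f : cube n -> bool) : Prop :=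
  forall g : cube n -> bool, monotone g -> eps < fdist R f g.

(* Total influence I(f) = n * Pr[f(x) <> f(y)] for a uniformly random edge (x,y)
   of H_n; a uniform edge is sampled as a uniform x and a uniform direction i. *)
Definition total_influence (R : realType) n (f : cube n -> bool) : R :=
  n%:R * (#|[set p : cube n * 'I_n | f p.1 != f (flip p.1 p.2)]|%:R
          / ((2 ^ n)%:R * n%:R)).

Definition log2 (R : realType) (x : R) : R := ln x / ln 2.

Definition walk n (x : cube n) (s : seq 'I_n) : seq (cube n) :=
  x :: scanl (@flip n) x s.

(* Standard binary search on the vertex sequence zs between indices lo < hi with
   f(z_lo) <> f(z_hi): keeps the invariant f(z_lo) = f(z_0), f(z_hi) <> f(z_0)
   (midpoint rule) and returns the index i of an influential edge (z_i, z_{i+1}).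
   [fuel] is just a termination bound (the size of zs suffices). *)
Fixpoint bsearch n (f : cube n -> bool) (zs : seq (cube n)) (x0 : cube n)
    (fuel lo hi : nat) : nat :=
  match fuel with
  | 0 => lo
  | fuel'.+1 =>
    if (hi <= lo.+1)%N then lo else
    let mid := (lo + hi)./2 in
    if f (nth x0 zs mid) == f (nth x0 zs lo)
    then bsearch f zs x0 fuel' mid hi
    else bsearch f zs x0 fuel' lo mid
  end.

Definition violating n (f : cube n -> bool) (u v : cube n) : bool :=
  (cube_le u v && f u && ~~ f v) || (cube_le v u && f v && ~~ f u).

Definition rejects n (f : cube n -> bool) (x : cube n) (s : seq 'I_n) : bool :=
  let zs := walk x s in
  let y := last x zs in
  (f x != f y) &&
  (let i := bsearch f zs x (size zs) 0 (size s) in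
   violating f (nth x zs i) (nth x zs i.+1)).

Definition Kmax (n : nat) : nat := up_log 2 n.

(* Rejection probability of the algorithm: k uniform in {0,..,Kmax n},
   l = 2^k, x uniform in {0,1}^n, and the l steps of the random walk each flip an
   independent uniformly random coordinate. *)
Definition reject_prob (R : realType) n (f : cube n -> bool) : R :=
  (Kmax n).+1%:R^-1 *
  \sum_(k < (Kmax n).+1)
    #|[set p : cube n * (2 ^ k).-tuple 'I_n | rejects f p.1 p.2]|%:R
      / ((2 ^ n)%:R * (n ^ (2 ^ k))%:R).

(* Main.v *)
Require Import Defs.
From HB Require Import structures.
From mathcomp Require Import all_boot all_order all_algebra.
From mathcomp Require Import reals exp.
From mathcomp Require Import ring lra zify.
Set Implicit Arguments. Unset Strict Implicit. Unset Printing Implicit Defensive.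
Import Order.TTheory GRing.Theory Num.Theory.
Local Open Scope ring_scope.

(** It is enough to find, for some [d], a graph [H] of violating
edges with all degrees at most [d] and average degree [mu] such that [mu^2 / d] is
at least [eps^2] up to logarithms.  Indeed, if a walk makes [h] steps along [H]
and [c] influential steps, then its rejection indicator is at least [h (2 - c)],
and the expectation of this is at least [l mu/n - l (l-1) (d/n) (I/n)] for walks of
length [l]; a power of two [l] close to [n mu / (2 d I)] gives rejection probability
of order [mu^2 / (d I)], and the choice of [l] costs a factor [log n].

If no such [H] exists, take a maximal graph of violating edges with degrees at most
[2^r] for every [r].  Orienting each violating edge towards the endpoint that is
saturated at the largest scale makes [phi], the average of the square root of the
out-degree, small.  So one needs the robust directed Talagrand inequality
[eps <= C sqrt(log n) phi] for every orientation of the violating edges.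

To prove it, sort [f] along the letters of a random word of [n log n] directions,
which makes [f] monotone with probability at least 1/2.  For a word [w] of length
[m] and a point [x], the value at [x] of [f] sorted along the subword [w_S] is a
Boolean function of [S]; the undirected Talagrand inequality applied to it bounds
the mean distance between [w_S f] and [w_(compl S) f] by [C sqrt(m/n) phi], once the
orientation of the violating edges has been transported along the sorting steps.
As sorting is a contraction and sorting twice along the same word changes nothing,
[w_(compl S) w_S f] and [w_S f] are then close as well; as [w_(compl S)] applied after
[w_S] is again a uniform word, the mean distance between [f] and its sorted version satisfies
[G(m) <= E G(|S|) + C sqrt(m/n) phi], hence is [O(sqrt(m/n) phi)].

The undirected inequality follows by random restriction: keeping each coordinate
alive with probability [p] moves the Fourier weight at level [1/p] to level one,
where it is bounded by [E sqrt(p D)], [D] being the out-degree. *)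

(** * Averages *)

Section Average.
Variable R : realType.

Definition avg (T : finType) (F : T -> R) : R := (#|T|%:R)^-1 * \sum_x F x.

Lemma eq_avg (T : finType) (F G : T -> R) : F =1 G -> avg F = avg G.
Proof. by move=> FG; congr (_ * _); apply: eq_bigr. Qed.

Lemma avg_le (T : finType) (F G : T -> R) :
  (forall x, F x <= G x) -> avg F <= avg G.
Proof.
by move=> FG; apply: ler_wpM2l; rewrite ?invr_ge0 ?ler0n //; apply: ler_sum.
Qed.

Lemma avg_ge0 (T : finType) (F : T -> R) : (forall x, 0 <= F x) -> 0 <= avg F.
Proof. by move=> F0; rewrite mulr_ge0 ?invr_ge0 ?ler0n ?sumr_ge0. Qed.

Lemma avgD (T : finType) (F G : T -> R) :
  avg (fun x => F x + G x) = avg F + avg G.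
Proof. by rewrite /avg big_split mulrDr. Qed.

Lemma avgZ (T : finType) (a : R) (F : T -> R) :
  avg (fun x => a * F x) = a * avg F.
Proof. by rewrite /avg -mulr_sumr mulrCA. Qed.

Lemma avgMr (T : finType) (a : R) (F : T -> R) :
  avg (fun x => F x * a) = avg F * a.
Proof. by rewrite /avg -mulr_suml mulrA. Qed.

Lemma avg_cst (T : finType) (a : R) : (0 < #|T|)%N -> avg (fun _ : T => a) = a.
Proof.
move=> T0; rewrite /avg sumr_const -[a *+ _]mulr_natl mulrA mulVf ?mul1r //.
by rewrite pnatr_eq0 -lt0n.
Qed.

Lemma avg_sum (T : finType) I (r : seq I) (P : pred I) (F : I -> T -> R) :
  avg (fun x => \sum_(i <- r | P i) F i x) = \sum_(i <- r | P i) avg (F i).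
Proof. by rewrite /avg exchange_big -mulr_sumr. Qed.

Lemma avg_exch (T U : finType) (F : T -> U -> R) :
  avg (fun x => avg (F x)) = avg (fun y => avg (F^~ y)).
Proof.
by rewrite /avg -!mulr_sumr mulrCA; congr (_ * (_ * _)); rewrite exchange_big.
Qed.

Lemma avg_reindex (T : finType) (h : T -> T) (F : T -> R) :
  injective h -> avg F = avg (fun x => F (h x)).
Proof. by move=> hI; rewrite /avg (reindex_inj hI). Qed.

Lemma avg_le_cst (T : finType) (F : T -> R) a :
  0 <= a -> (forall x, F x <= a) -> avg F <= a.
Proof.
move=> a0 Fa; case: (posnP #|T|) => [T0|T0]; first by rewrite /avg T0 invr0 mul0r.
by rewrite -[leRHS](avg_cst a T0); apply: avg_le.
Qed.

Lemma sqrtr_le_amgm (a s : R) : 0 < s -> 0 <= a ->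
  Num.sqrt a <= 2^-1 * (s + a / s).
Proof.
move=> s0 a0; set r := Num.sqrt a.
have ra : a = r ^+ 2 by rewrite sqr_sqrtr.
have : 0 <= s^-1 * (r - s) ^+ 2 by rewrite mulr_ge0 ?sqr_ge0 // invr_ge0 ltW.
have -> : s^-1 * (r - s) ^+ 2 = a / s - r *+ 2 + s by rewrite ra; field; rewrite gt_eqF.
lra.
Qed.

(** Jensen's inequality, by averaging the AM-GM bound at the single scale [s = sqrt (avg F)]. A zero
    average gives no scale to divide by and is treated apart. *)
Lemma avg_sqrt (T : finType) (F : T -> R) : (forall x, 0 <= F x) ->
  avg (fun x => Num.sqrt (F x)) <= Num.sqrt (avg F).
Proof.
move=> F0; have [A0|An0] := eqVneq (avg F) 0.
  rewrite A0 sqrtr0; case: (posnP #|T|) => [T0|T0]; first by rewrite /avg T0 invr0 mul0r.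
  have Fz x : F x = 0.
    move/eqP: A0; rewrite mulf_eq0 invr_eq0 pnatr_eq0 gtn_eqF //= psumr_eq0 //.
    by move/allP/(_ x); rewrite mem_index_enum => /(_ isT)/eqP.
  by rewrite (eq_avg (G := fun=> 0)) ?avg_cst // => x; rewrite Fz sqrtr0.
have T0 : (0 < #|T|)%N.
  by rewrite lt0n; apply: contra An0 => /eqP T0; rewrite /avg T0 invr0 mul0r.
have A0 : 0 < avg F by rewrite lt0r An0 avg_ge0.
set s := Num.sqrt _; have s0 : 0 < s by rewrite sqrtr_gt0.
apply: (@le_trans _ _ (avg (fun x => 2^-1 * (s + F x / s)))).
  by apply: avg_le => x; apply: sqrtr_le_amgm.
rewrite avgZ avgD avg_cst // avgMr.
have -> : avg F = s ^+ 2 by rewrite sqr_sqrtr // ltW.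
by rewrite expr2 mulfK ?gt_eqF //; lra.
Qed.

(** Cauchy-Schwarz against a vector of norm at most 1. The AM-GM bound holds at every positive
    scale; [sqrt V] is the best one, and for [V = 0] the scale is made arbitrarily small. *)
Lemma sum_mul_le_sqrt I (r : seq I) (P : pred I) (a b : I -> R) :
  \sum_(i <- r | P i) (a i) ^+ 2 <= 1 ->
  \sum_(i <- r | P i) a i * b i <= Num.sqrt (\sum_(i <- r | P i) (b i) ^+ 2).
Proof.
move=> a1; set V := \sum_(i <- r | P i) (b i) ^+ 2.
have V0 : 0 <= V by apply: sumr_ge0 => i _; apply: sqr_ge0.
suff amgm s : 0 < s -> \sum_(i <- r | P i) a i * b i <= 2^-1 * (s + V / s).
  have [Vz|Vn] := eqVneq V 0.
    rewrite Vz sqrtr0; apply/ler_addgt0Pl => e e0; rewrite addr0.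
    apply: le_trans (amgm _ e0) _; rewrite Vz mul0r; lra.
  have s0 : 0 < Num.sqrt V by rewrite sqrtr_gt0 lt0r Vn.
  apply: le_trans (amgm _ s0) _; set s := Num.sqrt V.
  have -> : V = s ^+ 2 by rewrite sqr_sqrtr.
  by rewrite expr2 mulfK ?gt_eqF //; lra.
move=> s0; apply: (@le_trans _ _ (\sum_(i <- r | P i) 2^-1 * (s * (a i) ^+ 2 + (b i) ^+ 2 / s))).
  apply: ler_sum => i _.
  have : 0 <= s^-1 * (b i - s * a i) ^+ 2 by rewrite mulr_ge0 ?sqr_ge0 // invr_ge0 ltW.
  have -> : s^-1 * (b i - s * a i) ^+ 2 = b i ^+ 2 / s - (a i * b i) *+ 2 + s * a i ^+ 2.
    by field; rewrite gt_eqF.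
  lra.
rewrite -mulr_sumr big_split /= -mulr_sumr -mulr_suml -/V.
have := ler_wpM2l (ltW s0) a1; lra.
Qed.

Lemma avg_prod (I J : finType) (phi : I -> J -> R) :
  avg (fun q : {ffun I -> J} => \prod_i phi i (q i)) = \prod_i avg (phi i).
Proof.
rewrite /avg big_split /= bigA_distr_bigA; congr (_ * _).
by rewrite card_ffun natrX -exprVn prodr_const.
Qed.

Definition upd (I : finType) (J : Type) (q : {ffun I -> J}) (i : I) (a : J) : {ffun I -> J} :=
  [ffun k => if k == i then a else q k].

(** Exchanging the fresh letter with the old value at [i] is an involution of the pairs. *)
Lemma avg_resample (I J : finType) (i : I) (F : {ffun I -> J} -> R) :
  avg F = avg (fun a => avg (fun q => F (upd q i a))).
Proof.
case: (posnP #|J|) => [J0|J0].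
  rewrite /avg J0 invr0 mul0r card_ffun J0.
  by rewrite exp0n ?invr0 ?mul0r //; apply/card_gt0P; exists i.
rewrite -[LHS](avg_cst _ J0) /avg.
rewrite -!mulr_sumr; congr (_ * (_ * _)); rewrite !pair_big /=.
pose h (p : J * {ffun I -> J}) := (p.2 i, upd p.2 i p.1).
have hK : involutive h.
  case=> a q; rewrite /h /= ffunE eqxx; congr (_, _); apply/ffunP => k.
  by rewrite !ffunE; case: eqP => // ->.
by rewrite (reindex_inj (inv_inj hK)).
Qed.

Lemma avg_pair (T U : finType) (F : T -> U -> R) :
  avg (fun x => avg (F x)) = avg (fun p : T * U => F p.1 p.2).
Proof.
by rewrite /avg -mulr_sumr mulrA -invfM -natrM -card_prod pair_big.
Qed.

End Average.

(** * A robust Talagrand inequality *)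

Lemma flipK n (i : 'I_n) : involutive (fun x : cube n => flip x i).
Proof. by move=> x; apply/ffunP => j; rewrite !ffunE; case: eqP => // ->; rewrite negbK. Qed.

Section Talagrand.
Variables (R : realType) (m : nat).
Implicit Types (g : cube m -> R) (Q U V : {set 'I_m}) (x y z : cube m).

Definition sgn x (i : 'I_m) : R := (-1) ^+ x i.
Definition chi V x : R := \prod_(i in V) sgn x i.
Definition fcoef g V : R := avg (fun x => chi V x * g x).

(** The sum over [V] expands the product of the factors [1 + sgn x i * sgn y i], one of which
    vanishes as soon as [x] and [y] differ. *)
Lemma sum_chi x y : \sum_V chi V x * chi V y = (2 ^ m)%:R * (x == y)%:R.
Proof.
transitivity (\prod_i (sgn x i * sgn y i + 1)).
  rewrite bigA_distr; apply: eq_bigr => V _.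
  by rewrite -big_split -big_mkcond.
have [->|xy] := eqVneq x y.
  rewrite mulr1 natrX (eq_bigr (fun=> 2%:R)) ?prodr_const ?card_ord // => i _.
  by rewrite /sgn -expr2 sqrr_sign.
have /existsP[i xyi] : [exists i, x i != y i].
  by rewrite -negb_forall; apply: contra xy => /forallP H; apply/eqP/ffunP => i; apply/eqP.
rewrite mulr0 (bigD1 i) //= /sgn; move: xyi.
by case: (x i); case: (y i) => //= _; rewrite ?mulr1 ?mul1r addNr mul0r.
Qed.

Lemma card_cube : #|{: cube m}| = (2 ^ m)%N.
Proof. by rewrite card_ffun card_bool card_ord. Qed.

Lemma cube_gt0 : (0 < #|{: cube m}|)%N.
Proof. by rewrite card_cube expn_gt0. Qed.

Lemma parseval g : \sum_V (fcoef g V) ^+ 2 = avg (fun x => (g x) ^+ 2).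
Proof.
transitivity (avg (fun x => avg (fun y => g x * g y * \sum_V chi V x * chi V y))).
  under [RHS]eq_avg => x do under eq_avg => y do rewrite mulr_sumr.
  under [RHS]eq_avg => x do rewrite avg_sum.
  rewrite avg_sum; apply: eq_bigr => V _; rewrite expr2 {1}/fcoef -avgMr.
  by apply: eq_avg => x; rewrite /fcoef -avgZ; apply: eq_avg => y; ring.
apply: eq_avg => x; under eq_avg => y do rewrite sum_chi.
rewrite /avg (bigD1 x) //= big1 ?addr0 => [|y yx]; last first.
  by rewrite eq_sym (negPf yx) !mulr0.
rewrite eqxx mulr1 card_cube expr2 mulrC mulfK //.
by rewrite pnatr_eq0 -lt0n expn_gt0.
Qed.

Definition mix Q y z : cube m := [ffun j => if j \in Q then y j else z j].

(** Exchanging the [Q]-coordinates of [y] and [z] is an involution of the pairs. *)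
Lemma avg_mix Q (F : cube m -> R) : avg (fun z => avg (fun y => F (mix Q y z))) = avg F.
Proof.
rewrite avg_pair.
pose h (p : cube m * cube m) := (mix Q p.2 p.1, mix Q p.1 p.2).
have hK : involutive h.
  case=> a b; congr (_, _); apply/ffunP => j; rewrite /= !ffunE;
    by case: (j \in Q).
rewrite (avg_reindex _ (inv_inj hK)).
under eq_avg => p.
  have -> : mix Q (h p).2 (h p).1 = p.1.
    by apply/ffunP => j; rewrite /= !ffunE; case: (j \in Q).
  over.
rewrite -(avg_pair (fun x (_ : cube m) => F x)); apply: eq_avg => x.
by rewrite avg_cst // cube_gt0.
Qed.

(** For [i] in [Q], this is the degree-one Fourier coefficient at [i] of the restriction of [g] to
    the subcube where the coordinates outside [Q] are frozen at [z]. *)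
Definition level1 g Q i z : R := avg (fun y => sgn y i * g (mix Q y z)).

Lemma fcoef_level1 g Q i V : i \in Q -> [disjoint V & Q] ->
  fcoef (level1 g Q i) V = fcoef g (i |: V).
Proof.
move=> iQ dVQ; rewrite /fcoef -(avg_mix Q (fun x => chi (i |: V) x * g x)).
apply: eq_avg => z; rewrite /level1 -avgZ; apply: eq_avg => y.
rewrite mulrA; congr (_ * _); rewrite mulrC {2}/chi big_setU1 /=; last first.
  by rewrite (disjointFl dVQ).
congr (_ * _); first by rewrite /sgn ffunE iQ.
by apply: eq_bigr => j jV; rewrite /sgn ffunE (disjointFr dVQ).
Qed.

(** Parseval in the variable [z], keeping only the sets disjoint from [Q]. *)
Lemma avg_sqr_level1_ge g Q i : i \in Q ->
  \sum_(V : {set 'I_m} | [disjoint V & Q]) (fcoef g (i |: V)) ^+ 2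
    <= avg (fun z => (level1 g Q i z) ^+ 2).
Proof.
move=> iQ; rewrite -parseval [leRHS](bigID (fun V : {set 'I_m} => [disjoint V & Q])) /=.
rewrite [X in _ <= X + _](eq_bigr (fun V => (fcoef g (i |: V)) ^+ 2)) => [|V dVQ].
  by rewrite lerDl sumr_ge0 // => V _; apply: sqr_ge0.
by rewrite fcoef_level1.
Qed.

(** Bessel's inequality for the restricted function: singletons carry only part of its Fourier
    weight. *)
Lemma sum_sqr_level1_le1 g Q z : (forall x, 0 <= g x <= 1) ->
  \sum_(i in Q) (level1 g Q i z) ^+ 2 <= 1.
Proof.
move=> g01; pose h y := g (mix Q y z).
apply: (@le_trans _ _ (\sum_V (fcoef h V) ^+ 2)); last first.
  rewrite parseval; apply: avg_le_cst => // y.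
  by rewrite expr_le1 //; case/andP: (g01 (mix Q y z)).
rewrite [leRHS](bigID (fun V => V \in [set [set i] | i in Q])) /=.
rewrite big_imset /=; last by move=> i j _ _; apply: set1_inj.
rewrite [X in _ <= X + _](eq_bigr (fun i => (level1 g Q i z) ^+ 2)) => [|i iQ].
  by rewrite lerDl sumr_ge0 // => V _; apply: sqr_ge0.
by congr (_ ^+ 2); apply: eq_avg => y; rewrite /chi big_set1.
Qed.

Variables (g : cube m -> bool) (o : cube m -> 'I_m -> bool).
Hypothesis go : forall x i, g x != g (flip x i) -> o x i || o (flip x i) i.

Let gR x : R := (g x)%:R.

(** Pairing [y] with [flip y i] turns the coefficient into half an average of signed differences of
    [g] along edges of direction [i]. Each nonzero difference is paid for by [o] at one of the two
    ends, and both ends have the same average, which cancels the half. *)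
Lemma level1_le Q i z : i \in Q ->
  `|level1 gR Q i z| <= avg (fun y => (o (mix Q y z) i)%:R).
Proof.
move=> iQ.
have mixF y : mix Q (flip y i) z = flip (mix Q y z) i.
  by apply/ffunP => j; rewrite !ffunE; case: eqP => // ->; rewrite iQ.
pose d y : R := sgn y i * (gR (mix Q y z) - gR (flip (mix Q y z) i)).
have -> : level1 gR Q i z = 2^-1 * avg d.
  have -> : avg d = avg (fun y => sgn y i * gR (mix Q y z)) + level1 gR Q i z; last first.
    by rewrite -/(level1 _ _ _ _); lra.
  rewrite [X in _ = _ + X](avg_reindex _ (inv_inj (@flipK _ i))) -avgD.
  apply: eq_avg => y; rewrite mixF /d mulrBr; congr (_ + _).
  by rewrite /sgn ffunE eqxx signrN mulNr.
pose e y : R := (o (mix Q y z) i)%:R.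
have dle y : `|d y| <= e y + e (flip y i).
  rewrite /d normrM /sgn normr_sign mul1r /e mixF /gR.
  have -> (a b : bool) : `|a%:R - b%:R| = (a != b)%:R :> R.
    by case: a; case: b; rewrite ?subrr ?normr0 ?subr0 ?sub0r ?normrN1 ?normr1.
  rewrite -natrD ler_nat; have := @go (mix Q y z) i.
  by case: (_ != _) => //= /(_ isT); case: (o _ _); case: (o _ _).
have eF : avg (fun y => e (flip y i)) = avg e.
  by rewrite [RHS](avg_reindex _ (inv_inj (@flipK _ i))).
rewrite normrM ger0_norm ?invr_ge0 ?ler0n //.
have : `|avg d| <= avg (fun y => e y + e (flip y i)).
  rewrite /avg normrM ger0_norm ?invr_ge0 ?ler0n //.
  apply: ler_wpM2l; first by rewrite invr_ge0 ler0n.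
  by apply: le_trans (ler_norm_sum _ _ _) _; apply: ler_sum.
rewrite avgD eF /e; lra.
Qed.

(** In each square one factor is bounded by [level1_le] and the other is kept; the kept factors form
    a vector of norm at most 1, so Cauchy-Schwarz applies for each [y]. *)
Lemma sum_sqr_level1_le Q z :
  \sum_(i in Q) (level1 gR Q i z) ^+ 2 <=
  avg (fun y => Num.sqrt (\sum_(i in Q) (o (mix Q y z) i)%:R)).
Proof.
have L1 : \sum_(i in Q) (level1 gR Q i z) ^+ 2 <= 1.
  by apply: sum_sqr_level1_le1 => x; rewrite /gR; case: (g x); rewrite ?lexx ?ler01.
apply: (@le_trans _ _ (avg (fun y => \sum_(i in Q) `|level1 gR Q i z| * (o (mix Q y z) i)%:R))).
  rewrite avg_sum; apply: ler_sum => i iQ.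
  rewrite avgZ -real_normK ?num_real // expr2.
  by apply: ler_wpM2l => //; apply: level1_le.
apply: avg_le => y.
rewrite [X in Num.sqrt X](eq_bigr (fun i => (o (mix Q y z) i)%:R ^+ 2)) => [|i _].
  apply: sum_mul_le_sqrt.
  by under eq_bigr do rewrite real_normK ?num_real //.
by case: (o _ _); rewrite ?expr1n ?expr0n.
Qed.

(** Noise stability at correlation [r], followed by its derivative in [r]. Its increment from 0 to 1
    is the variance of [g]. *)
Definition noise_sum (r : R) : R := \sum_U (fcoef gR U) ^+ 2 * r ^+ #|U|.
Definition noise_sum' (r : R) : R :=
  \sum_U (fcoef gR U) ^+ 2 * (#|U|%:R * r ^+ #|U|.-1).

(** A power series with nonnegative coefficients is convex on nonnegative arguments, so the slope at
    [b] bounds the increment. *)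
Lemma noise_sumB_le (a b : R) : 0 <= a -> a <= b ->
  noise_sum b - noise_sum a <= (b - a) * noise_sum' b.
Proof.
move=> a0 ab; rewrite /noise_sum /noise_sum' -sumrB mulr_sumr.
apply: ler_sum => U _; rewrite -mulrBr mulrCA; apply: ler_wpM2l; first exact: sqr_ge0.
rewrite subrXX; apply: ler_wpM2l; first by rewrite subr_ge0.
case: #|U| => [|k]; first by rewrite big_ord0 mul0r.
apply: (@le_trans _ _ (\sum_(i < k.+1) b ^+ k)); last first.
  by rewrite sumr_const card_ord mulr_natl.
apply: ler_sum => i _ /=.
have -> : b ^+ k = b ^+ (k - i) * b ^+ i by rewrite -exprD subnK // -ltnS.
apply: ler_wpM2l; first by rewrite exprn_ge0 // (le_trans a0).
by apply: lerXn2r; rewrite ?nnegrE ?(le_trans a0).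
Qed.

(** A uniform [q] makes this a random set containing each coordinate independently with probability
    [1/(N+1)], so that [avg] also serves for biased sets. *)
Definition zeros (N : nat) (q : {ffun 'I_m -> 'I_N.+1}) : {set 'I_m} := [set i | q i == ord0].

Lemma avg_zero N : avg (fun a : 'I_N.+1 => (a == ord0)%:R) = (N.+1%:R)^-1 :> R.
Proof.
rewrite /avg card_ord (bigD1 ord0) //= big1 ?addr0 ?eqxx ?mulr1 //.
by move=> i /negPf ->.
Qed.

Lemma avg_zeros N i V : i \notin V ->
  avg (fun q : {ffun 'I_m -> 'I_N.+1} =>
    ((i \in zeros q) && [disjoint V & zeros q])%:R)
  = (N.+1%:R)^-1 * (1 - (N.+1%:R)^-1) ^+ #|V| :> R.
Proof.
move=> iV; pose phi (j : 'I_m) (a : 'I_N.+1) : R :=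
  if j == i then (a == ord0)%:R else if j \in V then 1 - (a == ord0)%:R else 1.
rewrite (eq_avg (G := fun q : {ffun 'I_m -> 'I_N.+1} => \prod_j phi j (q j))); last first.
  move=> q; rewrite (bigD1 i) //= {1}/phi eqxx inE.
  case: (q i == ord0); rewrite /= ?mul0r // mul1r.
  have [dV|] := boolP [disjoint V & zeros q].
    rewrite big1 // => j ji; rewrite /phi (negPf ji); case: ifP => // jV.
    by have := disjointFr dV jV; rewrite inE => ->; rewrite subr0.
  rewrite -setI_eq0 => /set0Pn[j]; rewrite !inE => /andP[jV qj].
  rewrite (bigD1 j) /=; last by apply: contraNneq iV => <-.
  by rewrite /phi jV qj subrr; case: eqP iV => [<-|]; rewrite ?jV ?mul0r.
rewrite avg_prod (bigD1 i) //= {1}/phi eqxx avg_zero; congr (_ * _).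
rewrite (eq_bigr (fun j => if j \in V then 1 - (N.+1%:R)^-1 else 1)); last first.
  move=> j ji; rewrite /phi (negPf ji); case: ifP => _; last by rewrite avg_cst ?card_ord.
  by rewrite avgD avg_cst ?card_ord // -(avg_zero N) -mulN1r -avgZ; congr (_ + _);
     apply: eq_avg => x; rewrite mulN1r.
rewrite -big_mkcondr /= -prodr_const; apply: eq_bigl => j.
by case: eqP => // ->; rewrite (negPf iV).
Qed.

(* A random Q containing each coordinate with probability p = 1/(N+1): restricting
   the coordinates outside Q turns the Fourier weight at U into level-1 weight
   with probability |U| p (1-p)^(|U|-1). *)
Lemma noise_sum'_le (N : nat) (p := (N.+1%:R : R)^-1) :
  p * noise_sum' (1 - p) <= Num.sqrt p * avg (fun x => Num.sqrt (\sum_i (o x i)%:R)).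
Proof.
pose B := avg (fun q : {ffun 'I_m -> 'I_N.+1} =>
  avg (fun z => \sum_(i in zeros q) (level1 gR (zeros q) i z) ^+ 2)).
apply: (@le_trans _ _ B).
  rewrite /noise_sum' mulr_sumr.
  under eq_bigr => U _.
    have -> : p * (fcoef gR U ^+ 2 * (#|U|%:R * (1 - p) ^+ #|U|.-1)) =
      \sum_(i in U) fcoef gR U ^+ 2 * (p * (1 - p) ^+ #|U|.-1).
      by rewrite sumr_const -[RHS]mulr_natl; ring.
    over.
  rewrite (exchange_big_dep predT) //=.
  apply: (@le_trans _ _ (\sum_i avg (fun q : {ffun 'I_m -> 'I_N.+1} =>
      \sum_V fcoef gR (i |: V) ^+ 2 * ((i \in zeros q) && [disjoint V & zeros q])%:R))).
    apply: ler_sum => i _; rewrite avg_sum [leRHS](bigID (fun V : {set 'I_m} => i \notin V)) /=.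
    (* A set [U] containing [i] is [i |: V] with [i] outside [V]; the event that [Q] contains [i]
       and misses [V] has probability [p (1 - p)^(|U| - 1)]. *)
    rewrite (reindex_onto (fun V => i |: V) (fun U => U :\ i)) /=; last first.
      by move=> U iU; rewrite setD1K.
    rewrite (eq_bigl (fun V : {set 'I_m} => i \notin V)); last first.
      move=> V; rewrite setU11 /=; apply/eqP/idP => [<-|iV]; first by rewrite setD11.
      by rewrite setU1K.
    rewrite -[leLHS]addr0; apply: lerD.
      by apply: ler_sum => V iV; rewrite avgZ avg_zeros // cardsU1 iV.
    by apply: sumr_ge0 => V _; apply: avg_ge0 => q; rewrite mulr_ge0 ?sqr_ge0.
  rewrite -avg_sum; apply: avg_le => q; rewrite avg_sum [leRHS]big_mkcond /=.
  apply: ler_sum => i _; case: ifP => iq /=; last first.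
    by rewrite big1 // => V _; rewrite mulr0.
  apply: le_trans _ (avg_sqr_level1_ge gR iq); rewrite [leRHS]big_mkcond /=.
  by apply: ler_sum => V _; case: ifP => _; rewrite ?mulr1 ?mulr0.
apply: (@le_trans _ _ (avg (fun q : {ffun 'I_m -> 'I_N.+1} => avg (fun x =>
    Num.sqrt (\sum_(i in zeros q) (o x i)%:R))))).
  apply: avg_le => q.
  rewrite -(avg_mix (zeros q) (fun x => Num.sqrt (\sum_(i in zeros q) (o x i)%:R))).
  by apply: avg_le => z; apply: sum_sqr_level1_le.
(* For fixed [x], Jensen over the random set replaces the marks inside [Q] by their mean number, [p]
   times the out-degree. *)
rewrite avg_exch -avgZ; apply: avg_le => x /=.
apply: le_trans (avg_sqrt _) _ => [q|]; first by apply: sumr_ge0.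
rewrite -sqrtrM ?invr_ge0 //.
under eq_avg do rewrite big_mkcond /=.
rewrite avg_sum mulr_sumr le_eqVlt; apply/orP; left; apply/eqP; congr Num.sqrt.
apply: eq_bigr => i _; rewrite -/p.
have <- : avg (fun q : {ffun 'I_m -> 'I_N.+1} => (i \in zeros q)%:R) = p :> R.
  have := @avg_zeros N i set0; rewrite inE => /(_ isT); rewrite cards0 expr0 mulr1 -/p => <-.
  by apply: eq_avg => q; rewrite -setI_eq0 set0I eqxx andbT.
by rewrite -avgMr; apply: eq_avg => q; case: ifP; rewrite ?mul1r ?mul0r.
Qed.

(** The variance is the increment of [noise_sum] over [[0, 1]], cut at the points [1 - 4^-k]. The
    piece ending at [1 - p] has length [3 p] and contributes at most [3 sqrt p] times the right-hand
    average, and these square roots form a geometric series of sum 1. *)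
Lemma talagrand :
  avg gR - (avg gR) ^+ 2 <= 3 * avg (fun x => Num.sqrt (\sum_i (o x i)%:R)).
Proof.
set E := avg (fun x => Num.sqrt _).
have E0 : 0 <= E by apply: avg_ge0 => x; apply: sqrtr_ge0.
have S1 : noise_sum 1 = avg gR.
  rewrite /noise_sum; under eq_bigr do rewrite expr1n mulr1.
  by rewrite parseval; apply: eq_avg => x; rewrite /gR; case: (g x); rewrite ?expr1n ?expr0n.
have S0 : noise_sum 0 = avg gR ^+ 2.
  rewrite /noise_sum (bigD1 set0) //= cards0 expr0 mulr1 big1 ?addr0.
    by congr (_ ^+ 2); apply: eq_avg => x; rewrite /chi big_set0 mul1r.
  by move=> U U0; rewrite expr0n cards_eq0 (negPf U0) mulr0.
pose p k : R := 4^-1 ^+ k.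
have p0 k : 0 < p k by rewrite exprn_gt0 // invr_gt0.
have p1 k : p k <= 1 by rewrite exprn_ile1 ?invr_ge0 ?invf_le1 ?ler1n.
have pE k : p k = ((4 ^ k).-1.+1%:R)^-1.
  by rewrite prednK ?expn_gt0 // natrX /p exprVn.
have step k : noise_sum (1 - p k) - noise_sum 0 <= 3 * (1 - 2^-1 ^+ k) * E.
  elim: k => [|k IH]; first by rewrite /p expr0 !subrr mulr0 mul0r.
  have pS : p k = 4 * p k.+1 by rewrite /p exprS mulrA mulfV ?mul1r // pnatr_eq0.
  have := p0 k.+1; have := p1 k => pk pk'.
  have a0 : 0 <= 1 - p k by lra.
  have ab : 1 - p k <= 1 - p k.+1 by lra.
  have H := noise_sumB_le a0 ab.
  have := noise_sum'_le (4 ^ k.+1).-1; rewrite /= -pE -/E.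
  have -> : Num.sqrt (p k.+1) = 2^-1 ^+ k.+1.
    have -> : p k.+1 = (2^-1 ^+ k.+1) ^+ 2.
      by rewrite exprAC /p; congr (_ ^+ _); rewrite expr2; field.
    by rewrite sqrtr_sqr ger0_norm // exprn_ge0 // invr_ge0.
  move=> H2; have e2 : 2^-1 ^+ k = 2 * 2^-1 ^+ k.+1 :> R by rewrite exprS mulrA mulfV ?mul1r // pnatr_eq0.
  rewrite e2 in IH; move: IH H H2; rewrite pS.
  move: (p _) (2^-1 ^+ k.+1) (noise_sum _) (noise_sum _) (noise_sum _) (noise_sum' _) => q t s1 s2 s3 s4.
  lra.
rewrite -S0 -S1.
apply/ler_addgt0Pl => e e0.
set W := noise_sum' 1.
have W0 : 0 <= W.
  by apply: sumr_ge0 => U _; rewrite mulr_ge0 ?sqr_ge0 // expr1n mulr1.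
have We : 0 <= W / e by rewrite divr_ge0 // ltW.
(* The piece left between [1 - p k] and 1 contributes at most [p k * W]; since [k <= 4^k], this
   choice makes it at most [e]. *)
pose k := Num.bound (W / e); have Hk : W / e < k%:R by apply: archi_boundP.
have kp : p k * k%:R <= 1.
  rewrite /p exprVn mulrC ler_pdivrMr ?exprn_gt0 // mul1r -natrX ler_nat.
  by apply: ltnW; apply: ltn_expl.
have pW : p k * W <= e.
  rewrite ltr_pdivrMr // in Hk.
  apply: (@le_trans _ _ (p k * (k%:R * e))); first by rewrite ler_pM2l ?ltW.
  by rewrite mulrA -[leRHS]mul1r ler_pM2r.
have a0 : 0 <= 1 - p k by have := p1 k; lra.
have ab : 1 - p k <= 1 by have := p0 k; lra.
have := noise_sumB_le a0 ab; rewrite -/W => H; have := step k.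
have : 0 <= 2^-1 ^+ k * E by rewrite mulr_ge0 // exprn_ge0 // invr_ge0.
move: H pW; rewrite -/E.
move: (p k) (2^-1 ^+ k) (noise_sum _) (noise_sum _) (noise_sum _) => q t s1 s2 s3.
lra.
Qed.

End Talagrand.

(** * Sorting and transport of marks *)

Section Sorting.
Variable n : nat.
Implicit Types (h M : cube n -> bool) (x : cube n) (j l : 'I_n) (v : seq 'I_n).

Definition sort1 j h x := if x j then h x || h (flip x j) else h x && h (flip x j).

(* Carries the marks along when [h] is sorted in direction [j], so as to dominate the
   transport of "places where [h] and another function differ": a mark follows the
   value it sits on if the two values on the edge differ; if they agree, a function
   that differs from [h] at one endpoint only will, after sorting, differ from it at
   the top if the value is 0 and at the bottom if it is 1. *)
Definition move_marks j h M x :=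
  if h x == h (flip x j) then
    (if h x == x j then M x && M (flip x j) else M x || M (flip x j))
  else if sort1 j h x == h x then M x else M (flip x j).

Fixpoint sort_word v h := if v is j :: v' then sort_word v' (sort1 j h) else h.
Fixpoint carry_marks v h M :=
  if v is j :: v' then carry_marks v' (sort1 j h) (move_marks j h M) else M.

(** The premises describe a violating edge of direction [l] by its lower endpoint. *)
Definition covers l h M :=
  forall x, ~~ x l -> h x -> ~~ h (flip x l) -> M x || M (flip x l).
Definition separates h M h' M' := forall x, h x != h' x -> M x || M' x.

Lemma flip_same x j : flip x j j = ~~ x j.
Proof. by rewrite ffunE eqxx. Qed.

Lemma flip_other x j l : j != l -> flip x l j = x j.
Proof. by rewrite ffunE => /negPf->. Qed.

Lemma flipC x j l : flip (flip x j) l = flip (flip x l) j.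
Proof.
by apply/ffunP => k; rewrite !ffunE; case: (k == l); case: (k == j).
Qed.

Lemma sorted_in_sort1 l h x : ~~ x l -> sort1 l h x -> sort1 l h (flip x l).
Proof.
move=> xl; rewrite /sort1 flip_same xl (negPf xl) flipK => /andP[-> _].
by rewrite orbT.
Qed.

(** For [j = l] no violating edge of direction [l] survives the sorting. Otherwise everything
    happens in the square spanned by [j] and [l], whose configurations are enumerated. *)
Lemma covers_move_marks l j h M : covers l h M -> covers l (sort1 j h) (move_marks j h M).
Proof.
move=> C x xl; have [->|jl] := eqVneq j l.
  by move=> /(sorted_in_sort1 xl) ->.
have := C x xl; have := C (flip x j).
rewrite (flip_other x (_ : l != j)) 1?eq_sym // => /(_ xl).
rewrite /move_marks /sort1 (flip_other x jl) [flip (flip x l) j]flipC.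
case: (x j); case: (h x); case: (h (flip x j)); case: (h (flip x l));
case: (h (flip (flip x j) l)) => //=;
case: (M x); case: (M (flip x j)); case: (M (flip x l));
case: (M (flip (flip x j) l)) => //=; auto.
Qed.

Lemma separates_move_marks j h M h' M' : separates h M h' M' ->
  separates (sort1 j h) (move_marks j h M) (sort1 j h') (move_marks j h' M').
Proof.
move=> S x; have := S x; have := S (flip x j); rewrite /move_marks /sort1.
case: (x j); case: (h x); case: (h (flip x j)); case: (h' x);
case: (h' (flip x j)) => //=;
case: (M x); case: (M (flip x j)); case: (M' x); case: (M' (flip x j)) => //=; auto.
Qed.

(** Sorting in direction [l] changes [h] only at the two ends of violating edges, where [M] has a
    mark; [move_marks] swaps the marks of such an edge, so each end is marked before or after. *)
Lemma separates_sort1 l h M : covers l h M -> separates h M (sort1 l h) (move_marks l h M).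
Proof.
move=> C x; have := C x; have := C (flip x l).
rewrite flip_same flipK /move_marks /sort1.
case: (x l); case: (h x); case: (h (flip x l)); case: (M x); case: (M (flip x l)) => //=; auto.
Qed.

Lemma sort_word_cat u v h : sort_word (u ++ v) h = sort_word v (sort_word u h).
Proof. by elim: u h => //= j u IH h. Qed.

Lemma covers_carry_marks l v h M : covers l h M -> covers l (sort_word v h) (carry_marks v h M).
Proof. by elim: v h M => //= j v IH h M /(@covers_move_marks l j) /IH. Qed.

Lemma separates_carry_marks v h M h' M' : separates h M h' M' ->
  separates (sort_word v h) (carry_marks v h M) (sort_word v h') (carry_marks v h' M').
Proof. by elim: v h M h' M' => //= j v IH h M h' M' /(@separates_move_marks j) /IH. Qed.

Lemma carry_marks_cat u v h M : carry_marks (u ++ v) h M = carry_marks v (sort_word u h) (carry_marks u h M).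
Proof. by elim: u h M => //= j u IH h M. Qed.

(* Inserting a letter is detected by the marks of one of the two words: this is the
   orientation to which the Talagrand inequality is applied. *)
Lemma separates_insert l u v h M : covers l h M ->
  separates (sort_word (u ++ v) h) (carry_marks (u ++ v) h M)
            (sort_word (u ++ l :: v) h) (carry_marks (u ++ l :: v) h M).
Proof.
move=> C; rewrite !sort_word_cat !carry_marks_cat /=; apply: separates_carry_marks.
by apply: separates_sort1; apply: covers_carry_marks.
Qed.

Lemma eq_sort1 j h h' : h =1 h' -> sort1 j h =1 sort1 j h'.
Proof. by move=> hh x; rewrite /sort1 !hh. Qed.

Lemma eq_sort_word v h h' : h =1 h' -> sort_word v h =1 sort_word v h'.
Proof. by elim: v h h' => //= j v IH h h' /(@eq_sort1 j) /IH. Qed.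

Definition sorted_in l h := forall x, ~~ x l -> h x -> h (flip x l).

(** Sorting one direction does not spoil another; this is again a check on the square spanned by [j]
    and [l]. *)
Lemma sorted_in_keep_sort1 l j h : sorted_in l h -> sorted_in l (sort1 j h).
Proof.
move=> S x xl; have [->|jl] := eqVneq j l; first exact: sorted_in_sort1.
have := S x xl; have := S (flip x j).
rewrite (flip_other x (_ : l != j)) 1?eq_sym // => /(_ xl).
rewrite /sort1 (flip_other x jl) [flip (flip x l) j]flipC.
by case: (x j); case: (h x); case: (h (flip x j)); case: (h (flip x l));
  case: (h (flip (flip x j) l)) => //= [] // a b; by [apply: a | apply: b].
Qed.

Lemma sorted_in_sort_word l v h : l \in v -> sorted_in l (sort_word v h).
Proof.
have keep u h' : sorted_in l h' -> sorted_in l (sort_word u h').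
  by elim: u h' => //= j u IH h' /(@sorted_in_keep_sort1 l j) /IH.
elim: v h => //= j v IH h; rewrite inE => /orP[/eqP <-|]; last exact: IH.
by apply: keep; move=> x; apply: sorted_in_sort1.
Qed.

Lemma sort_word_id v h : (forall l, l \in v -> sorted_in l h) -> sort_word v h =1 h.
Proof.
elim: v => //= j v IH S x.
have e : sort1 j h =1 h.
  move=> y; have Sj := S j (mem_head _ _); rewrite /sort1.
  have [yj|/Sj] := boolP (y j).
    have := Sj (flip y j); rewrite flip_same yj flipK => /(_ isT).
    by case: (h y); case: (h (flip y j)) => // /(_ isT).
  by case: (h y) => // ->.
by rewrite (eq_sort_word v e) IH // => l lv; apply: S; rewrite inE lv orbT.
Qed.

(** Induction on the Hamming distance from [x] to [y], raising one coordinate of [x] at a time. *)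
Lemma sorted_monotone h : (forall l, sorted_in l h) -> monotone h.
Proof.
move=> S x y.
move: {2}#|[set i | x i != y i]| (leqnn #|[set i | x i != y i]|) => k.
elim: k x => [|k IH] x kle xy.
  suff -> : x = y by [].
  apply/ffunP => i; apply/eqP/idPn => xyi; move: kle; rewrite leqn0 => /eqP/cards0_eq.
  by move/setP/(_ i); rewrite !inE xyi.
have [->//|] := eqVneq x y => /eqP xny.
have /existsP[i xyi] : [exists i, x i != y i].
  rewrite -negb_forall; apply/negP => /forallP H; apply: xny.
  by apply/ffunP => i; apply/eqP.
have /forallP xyP := xy; have := xyP i; move: (xyi).
case xi : (x i); case yi : (y i) => //= _ _.
have : (h (flip x i) <= h y)%N.
  apply: IH.
    rewrite -ltnS; apply: leq_trans kle; apply: proper_card; apply/properP; split.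
      apply/subsetP => j; rewrite !inE ffunE; case: (j =P i) => // ->.
      by rewrite xi yi.
    by exists i; rewrite !inE ?ffunE ?eqxx xi yi.
  apply/forallP => j; rewrite ffunE; case: eqP => [->|_]; first by rewrite yi implybT.
  exact: xyP.
apply: leq_trans; have := S i x; rewrite xi => /(_ isT).
by case: (h x) => // ->.
Qed.

End Sorting.

(** * Sorting along random words *)

Section Distance.
Variables (R : realType) (n : nat).
Implicit Types (h M : cube n -> bool) (x : cube n) (j l : 'I_n) (v : seq 'I_n).

(** Concavity: spreading two numbers apart at constant sum decreases their product, hence the square
    of the sum of their roots. *)
Lemma sqrtr_spread (a b c d : R) : 0 <= c -> c <= a -> c <= b -> c + d = a + b ->
  Num.sqrt c + Num.sqrt d <= Num.sqrt a + Num.sqrt b.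
Proof.
move=> c0 ca cb e; have d0 : 0 <= d by lra.
have a0 := le_trans c0 ca; have b0 := le_trans c0 cb.
rewrite -(@ler_pXn2r _ 2) ?nnegrE ?addr_ge0 ?sqrtr_ge0 // !sqrrD !sqr_sqrtr //.
rewrite -!sqrtrM //.
suff : Num.sqrt (c * d) <= Num.sqrt (a * b) by lra.
by apply: ler_wsqrtr; nra.
Qed.

Lemma avg_le_edges j (F G : cube n -> R) :
  (forall x, F x + F (flip x j) <= G x + G (flip x j)) -> avg F <= avg G.
Proof.
move=> H; have : avg F + avg F <= avg G + avg G; last by lra.
rewrite {2}(avg_reindex F (inv_inj (@flipK _ j))) {2}(avg_reindex G (inv_inj (@flipK _ j))).
by rewrite -!avgD; apply: avg_le.
Qed.

(** The rule applied on an edge depends on [h] and not on [i]. Hence the mark counts at its two ends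
    are kept, swapped, or replaced by the counts of conjunctions and disjunctions, which have the
    same sum and are more spread. *)
Lemma avg_sqrt_move_marks_le (I : finType) j h (M : I -> cube n -> bool) :
  avg (fun x => Num.sqrt (\sum_i (move_marks j h (M i) x)%:R : R)) <=
  avg (fun x => Num.sqrt (\sum_i (M i x)%:R)).
Proof.
apply: (avg_le_edges (j := j)) => x; rewrite /move_marks flipK [h (flip x j) == h x]eq_sym.
pose c : R := \sum_i (M i x && M i (flip x j))%:R.
pose d : R := \sum_i (M i x || M i (flip x j))%:R.
have cd : Num.sqrt c + Num.sqrt d <=
    Num.sqrt (\sum_i (M i x)%:R) + Num.sqrt (\sum_i (M i (flip x j))%:R).
  apply: sqrtr_spread; first by apply: sumr_ge0.
  - by apply: ler_sum => i _; case: (M i x); case: (M i _).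
  - by apply: ler_sum => i _; case: (M i x); case: (M i _).
  - by rewrite -!big_split; apply: eq_bigr => i _; case: (M i x); case: (M i _); rewrite /= ?addr0 ?add0r.
have cE : \sum_i (M i (flip x j) && M i x)%:R = c by apply: eq_bigr => i _; rewrite andbC.
have dE : \sum_i (M i (flip x j) || M i x)%:R = d by apply: eq_bigr => i _; rewrite orbC.
have [e|ne] := eqVneq (h x) (h (flip x j)).
  rewrite -e flip_same; case: (h x); case: (x j) => /=; rewrite ?cE ?dE -/c -/d //;
    by rewrite addrC.
rewrite /sort1 flip_same flipK; move: ne.
by case: (x j); case: (h x); case: (h (flip x j)) => //= _; rewrite addrC.
Qed.

Lemma avg_sqrt_carry_marks_le (I : finType) v h (M : I -> cube n -> bool) :
  avg (fun x => Num.sqrt (\sum_i (carry_marks v h (M i) x)%:R : R)) <=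
  avg (fun x => Num.sqrt (\sum_i (M i x)%:R)).
Proof.
elim: v h M => [|j v IH] h M //=.
exact: le_trans (IH _ (fun i => move_marks j h (M i))) (avg_sqrt_move_marks_le _ _ _).
Qed.

Definition dist h h' : R := avg (fun x => (h x != h' x)%:R).

Lemma dist_ge0 h h' : 0 <= dist h h'.
Proof. by apply: avg_ge0. Qed.

Lemma dist_triangle h2 h1 h3 : dist h1 h3 <= dist h1 h2 + dist h2 h3.
Proof.
rewrite /dist -avgD; apply: avg_le => x; rewrite -natrD ler_nat.
by case: (h1 x); case: (h2 x); case: (h3 x).
Qed.

Lemma distC h1 h2 : dist h1 h2 = dist h2 h1.
Proof. by apply: eq_avg => x; rewrite eq_sym. Qed.

Lemma eq_distr h1 h2 h3 : h2 =1 h3 -> dist h1 h2 = dist h1 h3.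
Proof. by move=> e; apply: eq_avg => x; rewrite e. Qed.

Lemma dist_sort1 j h h' : dist (sort1 j h) (sort1 j h') <= dist h h'.
Proof.
apply: (avg_le_edges (j := j)) => x; rewrite -!natrD ler_nat /sort1 flip_same flipK.
by case: (x j); case: (h x); case: (h' x); case: (h (flip x j)); case: (h' (flip x j)).
Qed.

Lemma dist_sort_word v h h' : dist (sort_word v h) (sort_word v h') <= dist h h'.
Proof. by elim: v h h' => //= j v IH h h'; apply: le_trans (IH _ _) (dist_sort1 _ _ _). Qed.

End Distance.

(** * Averages over uniform random words *)

Section Words.
Variables (R : realType) (J : finType).

Fixpoint wavg k (F : seq J -> R) : R :=
  if k is k'.+1 then avg (fun a => wavg k' (fun v => F (a :: v))) else F [::].

Lemma eq_wavg k (F G : seq J -> R) : F =1 G -> wavg k F = wavg k G.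
Proof.
elim: k F G => [|k IH] F G FG //=.
by apply: eq_avg => a; apply: IH => v; apply: FG.
Qed.

Lemma wavg_le k (F G : seq J -> R) :
  (forall v, size v = k -> F v <= G v) -> wavg k F <= wavg k G.
Proof.
elim: k F G => [|k IH] F G FG /=; first exact: FG.
by apply: avg_le => a; apply: IH => v vk; apply: FG; rewrite /= vk.
Qed.

Lemma wavgD k (F G : seq J -> R) :
  wavg k (fun v => F v + G v) = wavg k F + wavg k G.
Proof.
elim: k F G => [|k IH] F G //=; rewrite -avgD.
by apply: eq_avg => a; apply: IH.
Qed.

Lemma wavgZ k c (F : seq J -> R) : wavg k (fun v => c * F v) = c * wavg k F.
Proof. by elim: k F => [|k IH] F //=; rewrite -avgZ; apply: eq_avg => a; apply: IH. Qed.

Lemma wavg_cst k c : (0 < #|J|)%N -> wavg k (fun=> c) = c.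
Proof. by move=> J0; elim: k => //= k IH; rewrite (eq_avg (G := fun=> c)) ?avg_cst. Qed.

Lemma wavg_sum (T : finType) k (F : T -> seq J -> R) :
  wavg k (fun v => \sum_i F i v) = \sum_i wavg k (F i).
Proof. by elim: k F => [|k IH] F //=; rewrite -avg_sum; apply: eq_avg => a; rewrite IH. Qed.

(** Distinct positions of a uniform function carry independent uniform letters; the first one is
    resampled and the others are left to the induction. *)
Lemma avg_word (m : nat) (s : seq 'I_m) (F : seq J -> R) : (0 < #|J|)%N -> uniq s ->
  avg (fun w : {ffun 'I_m -> J} => F [seq w i | i <- s]) = wavg (size s) F.
Proof.
move=> J0; elim: s F => [|i s IH] F /=.
  by move=> _; rewrite avg_cst // card_ffun card_ord expn_gt0 J0.
case/andP=> si us; rewrite (avg_resample i); apply: eq_avg => a.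
rewrite -IH //; apply: eq_avg => w; congr (F (_ :: _)); first by rewrite ffunE eqxx.
by apply/eq_in_map => k ks; rewrite ffunE; case: eqP => // ki; rewrite -ki ks in si.
Qed.

End Words.

(** * The robust directed inequality through random subwords *)

Section Tracker.
Variables (R : realType) (n : nat).
Variables (f : cube n -> bool) (M0 : 'I_n -> cube n -> bool).
Hypothesis cov : forall l, covers l f (M0 l).
Hypothesis n0 : (0 < n)%N.

Definition subword m (w : {ffun 'I_m -> 'I_n}) (S : cube m) : seq 'I_n :=
  [seq w i | i <- enum 'I_m & S i].

Lemma subword_flip m (w : {ffun 'I_m -> 'I_n}) (S : cube m) i : ~~ S i ->
  exists u v, subword w S = u ++ v /\ subword w (flip S i) = u ++ w i :: v.
Proof.
move=> Si; rewrite /subword; have := enum_uniq 'I_m.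
have /splitPr[p q] : i \in enum 'I_m by rewrite mem_enum.
rewrite uniq_catC /= => /andP[]; rewrite mem_cat negb_or => /andP[iq ip] _.
exists [seq w k | k <- p & S k], [seq w k | k <- q & S k].
rewrite !filter_cat /= (negPf Si) flip_same Si !map_cat /=; split=> //.
have E s : i \notin s -> [seq k <- s | flip S i k] = [seq k <- s | S k].
  move=> si; apply: eq_in_filter => k ks; rewrite ffunE; case: eqP => // ki.
  by rewrite ki (negPf si) in ks.
by rewrite !E.
Qed.

(** This is the hypothesis of [talagrand] for the function of [S] giving the value at [x] of [f]
    sorted along the subword: flipping [S] at [i] inserts or deletes the letter [w i]. *)
Lemma tracker m (w : {ffun 'I_m -> 'I_n}) x S i :
  sort_word (subword w S) f x != sort_word (subword w (flip S i)) f x ->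
  carry_marks (subword w S) f (M0 (w i)) x || carry_marks (subword w (flip S i)) f (M0 (w i)) x.
Proof.
have [Si|Si] := boolP (S i); last first.
  by have [u [v [-> ->]]] := subword_flip w Si; apply: separates_insert.
have Si' : ~~ flip S i i by rewrite flip_same Si.
have [u [v []]] := subword_flip w Si'; rewrite flipK => -> ->.
by rewrite eq_sym orbC; apply: separates_insert.
Qed.

Definition phi : R := avg (fun x => Num.sqrt (\sum_l (M0 l x)%:R)).

Lemma phi_ge0 : 0 <= phi.
Proof. by apply: avg_ge0 => x; apply: sqrtr_ge0. Qed.

Definition compl m (S : cube m) : cube m := [ffun i => ~~ S i].

Lemma complK m : involutive (@compl m).
Proof. by move=> S; apply/ffunP => i; rewrite !ffunE negbK. Qed.

(** For Boolean [a], [b] and mean [p], disagreement is [(a - b)^2 <= 2 (a - p)^2 + 2 (b - p)^2],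
    made linear by [a^2 = a]. Complementation preserves the measure, so each square averages to the
    variance. *)
Lemma avg_disagree m (g : cube m -> bool) :
  avg (fun S => (g S != g (compl S))%:R) <=
  4 * (avg (fun S => (g S)%:R) - (avg (fun S => (g S)%:R)) ^+ 2) :> R.
Proof.
set p : R := avg (fun S => (g S)%:R).
pose a S : R := (g S)%:R.
have cE : avg (fun S => a (compl S)) = p.
  exact: (esym (avg_reindex a (inv_inj (@complK m)))).
apply: (@le_trans _ _ (avg (fun S => 2 * (1 - 2 * p) * a S + 2 * (1 - 2 * p) * a (compl S)
                                 + 4 * p ^+ 2))).
  apply: avg_le => S; rewrite /a.
  case: (g S); case: (g (compl S)) => /=.
  - have : 0 <= (1 - p) ^+ 2 by apply: sqr_ge0. nra.
  - have : 0 <= (1 - 2 * p) ^+ 2 by apply: sqr_ge0. nra.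
  - have : 0 <= (1 - 2 * p) ^+ 2 by apply: sqr_ge0. nra.
  - have : 0 <= p ^+ 2 by apply: sqr_ge0. nra.
rewrite avgD avg_cst ?cube_gt0 // avgD !avgZ cE -/p.
rewrite le_eqVlt; apply/orP; left; apply/eqP.
ring.
Qed.

Lemma avg_dist_compl m :
  avg (fun w : {ffun 'I_m -> 'I_n} => avg (fun S : cube m =>
    dist R (sort_word (subword w S) f) (sort_word (subword w (compl S)) f))) <=
  12 * (Num.sqrt (m%:R / n%:R) * phi).
Proof.
apply: (@le_trans _ _ (avg (fun w : {ffun 'I_m -> 'I_n} => avg (fun x =>
  12 * avg (fun S : cube m => Num.sqrt (\sum_i (carry_marks (subword w S) f (M0 (w i)) x)%:R)))))).
  apply: avg_le => w; rewrite /dist avg_exch; apply: avg_le => x.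
  apply: le_trans (avg_disagree (fun S => sort_word (subword w S) f x)) _.
  have := @talagrand R m (fun S => sort_word (subword w S) f x)
    (fun S i => carry_marks (subword w S) f (M0 (w i)) x) (fun S i => @tracker m w x S i).
  lra.
under eq_avg do rewrite avgZ avg_exch.
rewrite avgZ ler_pM2l //.
apply: (@le_trans _ _ (avg (fun w : {ffun 'I_m -> 'I_n} => avg (fun x =>
   Num.sqrt (\sum_i (M0 (w i) x)%:R))))).
  apply: avg_le => w; apply: avg_le_cst.
    by apply: avg_ge0 => x; apply: sqrtr_ge0.
  by move=> S; apply: (avg_sqrt_carry_marks_le _ _ _ (fun i => M0 (w i))).
(* The letters [w i] are uniform, so the mean number of marked letters at [x] is [m/n] times the
   out-degree of [x]; Jensen moves this mean under the root. *)
rewrite avg_exch /phi -avgZ; apply: avg_le => x.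
apply: le_trans (avg_sqrt _) _ => [w|]; first by apply: sumr_ge0.
rewrite -sqrtrM ?divr_ge0 //; apply: ler_wsqrtr; rewrite avg_sum.
rewrite (eq_bigr (fun=> n%:R^-1 * \sum_l (M0 l x)%:R)) => [|i _].
  by rewrite sumr_const card_ord -[leLHS]mulr_natl mulrA.
have := @avg_word R 'I_n m [:: i] (fun v => \sum_(l <- v) (M0 l x)%:R).
rewrite card_ord => /(_ n0 isT) /=.
under eq_avg do rewrite big_seq1.
move=> ->; under eq_avg do rewrite big_seq1.
by rewrite /avg card_ord.
Qed.

Definition drift k : R := wavg k (fun v => dist R (sort_word v f) f).

Lemma drift_le_rec m :
  drift m <= avg (fun S : cube m => drift #|[set i | S i]|)
           + 24 * (Num.sqrt (m%:R / n%:R) * phi).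
Proof.
have n0' : (0 < #|'I_n|)%N by rewrite card_ord.
pose e (S : cube m) := [seq i <- enum 'I_m | S i].
have eE S : size (e S) = #|[set i | S i]|.
  rewrite -(card_uniqP (filter_uniq S (enum_uniq 'I_m))); apply: eq_card => i.
  by rewrite inE mem_filter mem_enum andbT.
have eu S : uniq (e S ++ e (compl S)).
  rewrite cat_uniq !(filter_uniq _ (enum_uniq _)) /= andbT.
  by apply/hasPn => i; rewrite !mem_filter ffunE => /andP[/negPf ->].
have es S : size (e S ++ e (compl S)) = m.
  rewrite size_cat !eE -[RHS](card_ord m) -(cardsC [set i | S i]); congr (_ + _)%N.
  by apply: eq_card => i; rewrite !inE ffunE.
(* For each [S], the two complementary subwords together read every position once, so their
   concatenation is a uniform word of length [m]. *)
have -> : drift m = avg (fun w : {ffun 'I_m -> 'I_n} => avg (fun S : cube m =>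
    dist R (sort_word (subword w (compl S)) (sort_word (subword w S) f)) f)).
  rewrite avg_exch -[LHS](avg_cst _ (cube_gt0 m)); apply: eq_avg => S.
  transitivity (wavg (size (e S ++ e (compl S))) (fun v => dist R (sort_word v f) f)).
    by rewrite es.
  rewrite -avg_word //.
  by apply: eq_avg => w; rewrite map_cat sort_word_cat.
have -> : avg (fun S : cube m => drift #|[set i | S i]|) =
   avg (fun w : {ffun 'I_m -> 'I_n} => avg (fun S : cube m =>
     dist R (sort_word (subword w S) f) f)).
  rewrite avg_exch; apply: eq_avg => S.
  rewrite (avg_word (fun v => dist R (sort_word v f) f)) ?(filter_uniq _ (enum_uniq _)) ?card_ord // /drift.
  by rewrite eE.
have := avg_dist_compl m; set D := avg _ => Dle.
apply: (@le_trans _ _ (avg (fun w : {ffun 'I_m -> 'I_n} => avg (fun S : cube m =>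
     dist R (sort_word (subword w S) f) f)) + 2 * D)); last by lra.
rewrite /D -avgZ -avgD; apply: avg_le => w; rewrite -avgZ -avgD; apply: avg_le => S.
set a := subword w S; set b := subword w (compl S).
(* The function [sort_word b f] is fixed by sorting along [b], so contraction applies. Two triangle
   inequalities, through [sort_word b f] and then [sort_word a f], cost the distance between these
   two twice. *)
have idem : dist R (sort_word b (sort_word a f)) (sort_word b f) <= dist R (sort_word a f) (sort_word b f).
  rewrite -(eq_distr R _ (sort_word_id (h := sort_word b f) (v := b) _)); first exact: dist_sort_word.
  by move=> l lb; apply: sorted_in_sort_word.
have := dist_triangle R (sort_word b f) (sort_word b (sort_word a f)) f.
have := dist_triangle R (sort_word a f) (sort_word b f) f.
rewrite [dist R (sort_word b f) (sort_word a f)]distC; move: idem; lra.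
Qed.

Lemma avg_card m : avg (fun S : cube m => #|[set i | S i]|%:R) = m%:R / 2 :> R.
Proof.
set a := avg _; suff : a + a = m%:R by move=> <-; field.
rewrite {2}/a (avg_reindex _ (inv_inj (@complK m))) -avgD.
rewrite -[RHS](avg_cst _ (cube_gt0 m)); apply: eq_avg => S; rewrite -natrD.
rewrite -[in RHS](card_ord m) -(cardsC [set i | S i]); congr (_ + _)%N%:R.
by apply: eq_card => i; rewrite !inE ffunE.
Qed.

(** Strong induction on [m]. The mean size of [S] is [m/2] and [sqrt (1/2) <= 3/4], so the constant
    reproduces itself: [96 * 3/4 + 24 = 96]. *)
Lemma drift_le m : drift m <= 96 * (Num.sqrt (m%:R / n%:R) * phi).
Proof.
have key (k : nat) : Num.sqrt (k%:R / n%:R) * phi = Num.sqrt k%:R * (Num.sqrt n%:R^-1 * phi).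
  by rewrite sqrtrM // mulrA.
rewrite key; set b := Num.sqrt n%:R^-1 * phi.
have b0 : 0 <= b by rewrite mulr_ge0 ?sqrtr_ge0 ?phi_ge0.
elim/ltn_ind: m => -[|m] IH.
  rewrite /drift /= sqrtr0 mul0r mulr0 /dist (eq_avg (G := fun=> 0)) ?avg_cst ?cube_gt0 // => x.
  by rewrite eqxx.
set q : R := Num.sqrt m.+1%:R; have q0 : 0 < q by rewrite sqrtr_gt0.
have := drift_le_rec m.+1; rewrite key -/b -/q => rec.
pose full : cube m.+1 := [ffun=> true].
have cfull : #|[set i | full i]| = m.+1.
  by rewrite -[RHS](card_ord m.+1); apply: eq_card => i; rewrite !inE ffunE.
pose s (S : cube m.+1) : R := 96 * (Num.sqrt #|[set i | S i]|%:R * b).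
(* The full set brings [drift m.+1] back on the right-hand side, but only with weight [t < 1], so it
   can be absorbed. *)
pose t : R := (2 ^ m.+1)%:R^-1.
have t0 : 0 < t by rewrite invr_gt0 ltr0n expn_gt0.
have t1 : t < 1.
  by rewrite invf_lt1 ?ltr0n ?expn_gt0 // ltr1n -[ltnLHS](expn0 2) ltn_exp2l.
have H : avg (fun S : cube m.+1 => drift #|[set i | S i]|) - avg s
         <= t * (drift m.+1 - 96 * (q * b)).
  rewrite /avg card_cube -mulrBr -/t; apply: ler_wpM2l; first exact: ltW.
  rewrite -sumrB (bigD1 full) //= /s cfull -/q -[leRHS]addr0; apply: lerD => //.
  apply: sumr_le0 => S Sf; rewrite subr_le0; apply: IH.
  rewrite -[ltnRHS]cfull; apply: proper_card; apply/properP; split.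
    by apply/subsetP => i; rewrite !inE ffunE.
  have /existsP[i Si] : [exists i, ~~ S i].
    rewrite -negb_forall; apply: contra Sf => /forallP Sf.
    by apply/eqP/ffunP => i; rewrite ffunE Sf.
  by exists i; rewrite !inE ?ffunE // (negPf Si).
have As : avg s <= 72 * (q * b).
  rewrite /s avgZ avgMr.
  have : avg (fun S : cube m.+1 => Num.sqrt #|[set i | S i]|%:R) <= 3 / 4 * q.
    apply: le_trans (avg_sqrt _) _ => //; rewrite avg_card.
    have -> : 3 / 4 * q = Num.sqrt ((3 / 4) ^+ 2 * m.+1%:R).
      by rewrite sqrtrM ?sqr_ge0 // sqrtr_sqr ger0_norm // divr_ge0.
    by apply: ler_wsqrtr; have := ler0n R m.+1; rewrite expr2; lra.
  move=> /(ler_wpM2r b0); rewrite -mulrA; lra.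
have : (1 - t) * (drift m.+1 - 96 * (q * b)) <= 0.
  move: (q * b) (drift _) (avg _) (avg s) rec H As => x y z u rec H As.
  lra.
by rewrite pmulr_rle0 ?subr_gt0 // subr_le0.
Qed.

End Tracker.

(** * Coupon collector: long words sort completely *)

Section Coupon.
Variables (R : realType) (n : nat).
Hypothesis n2 : (2 <= n)%N.

Lemma wavg_missing (l : 'I_n) k :
  wavg k (fun v => (l \notin v)%:R) = (1 - n%:R^-1) ^+ k :> R.
Proof.
elim: k => [|k IH] /=; first by rewrite expr0.
have c0 : (0 < #|'I_n|)%N by rewrite card_ord ltnW.
rewrite (eq_avg (G := fun a => (1 - (a == l)%:R) * (1 - n%:R^-1) ^+ k)) => [|a].
  rewrite avgMr exprS; congr (_ * _).
  transitivity (avg (fun a : 'I_n => 1 + -1 * (a == l)%:R) : R).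
    by apply: eq_avg => a; rewrite mulN1r.
  rewrite avgD avgZ avg_cst // mulN1r /avg card_ord (bigD1 l) //= eqxx big1 ?addr0 ?mulr1 //.
  by move=> i /negPf ->.
rewrite -IH -wavgZ; apply: eq_wavg => v; rewrite inE negb_or eq_sym.
by case: (a == l); rewrite /= ?subrr ?mul0r // subr0 mul1r.
Qed.

Lemma exprDr_ge (y : R) k : 0 <= y -> 1 + k%:R * y <= (1 + y) ^+ k.
Proof.
move=> y0; elim: k => [|k IH]; first by rewrite expr0 mul0r addr0.
rewrite exprS; apply: le_trans (ler_wpM2l _ IH); last by lra.
rewrite -natr1; have : 0 <= k%:R * y ^+ 2 by rewrite mulr_ge0 ?sqr_ge0.
rewrite expr2; lra.
Qed.

(** Bernoulli's inequality for [1 + 1/(n-1)], the inverse of [1 - 1/n], gives [(1 - 1/n)^n <= 1/2];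
    then [n <= 2 ^ Kmax n] leaves one spare factor [1/2]. *)
Lemma missing_le : n%:R * (1 - n%:R^-1) ^+ (n * (Kmax n).+1) <= 2^-1 :> R.
Proof.
have N0 : 0 < n%:R - 1 :> R by rewrite subr_gt0 ltr1n.
have n0 : 0 < n%:R :> R by rewrite ltr0n ltnW.
pose y : R := (n%:R - 1)^-1; have y0 : 0 < y by rewrite invr_gt0.
have e : 1 - n%:R^-1 = (1 + y)^-1 :> R.
  by rewrite /y; field; rewrite ?gt_eqF //=; lra.
have half : (1 - n%:R^-1) ^+ n <= 2^-1 :> R.
  rewrite e exprVn lef_pV2 ?posrE ?exprn_gt0 ?addr_gt0 //.
  apply: le_trans (exprDr_ge n (ltW y0)).
  suff : 1 <= n%:R * y by lra.
  by rewrite /y ler_pdivlMr // mul1r; lra.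
have q0 : 0 <= (1 - n%:R^-1) ^+ n :> R by rewrite e exprn_ge0 // invr_ge0 addr_ge0 // ltW.
rewrite exprM; apply: (@le_trans _ _ (n%:R * 2^-1 ^+ (Kmax n).+1)).
  by apply: ler_wpM2l; [rewrite ltW | apply: lerXn2r; rewrite ?nnegrE ?invr_ge0].
rewrite exprS mulrCA -[leRHS]mulr1; apply: ler_wpM2l; first by rewrite invr_ge0.
rewrite exprVn ler_pdivrMr ?exprn_gt0 // mul1r -natrX ler_nat.
exact: up_logP.
Qed.

Lemma fdist_dist (f g : cube n -> bool) : fdist R f g = dist R f g.
Proof.
rewrite /fdist /dist /avg card_cube mulrC; congr (_ * _).
by rewrite -sum1_card natr_sum big_mkcond /=; apply: eq_bigr => x _; rewrite inE; case: (_ != _).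
Qed.

(** Union bound: [eps] times one minus the number of missing letters is below the distance for every
    word, since a word with all letters makes [f] monotone and any other makes this quantity at most
    0. *)
Lemma drift_ge (f : cube n -> bool) (eps : R) : 0 <= eps -> far_from_monotone eps f ->
  eps / 2 <= drift R f (n * (Kmax n).+1).
Proof.
move=> e0 far; have c0 : (0 < #|'I_n|)%N by rewrite card_ord ltnW.
set k := (n * _)%N.
apply: (@le_trans _ _ (wavg k (fun v : seq 'I_n => eps * (1 + (-1) * \sum_l (l \notin v)%:R)))).
  rewrite wavgZ wavgD wavg_cst // wavgZ wavg_sum.
  under eq_bigr do rewrite wavg_missing.
  rewrite sumr_const card_ord -[_ *+ n]mulr_natl mulN1r.
  by apply: ler_wpM2l => //; have := missing_le; rewrite -/k; lra.
apply: wavg_le => v _.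
have [all|] := boolP [forall l, l \in v].
  have S0 : \sum_l (l \notin v)%:R = 0 :> R.
    by apply: big1 => l _; rewrite (forallP all).
  rewrite S0 mulr0 addr0 mulr1 distC -fdist_dist ltW //; apply: far.
  by apply: sorted_monotone => l; apply: sorted_in_sort_word; apply: (forallP all).
rewrite negb_forall => /existsP[l lv]; apply: le_trans (dist_ge0 R _ _).
rewrite mulr_ge0_le0 // mulN1r subr_le0 (bigD1 l) //= lv lerDl.
by apply: sumr_ge0.
Qed.

End Coupon.

(** * Rejection rate of a walk *)

Section Walks.
Variables (R : realType) (n : nat) (f : cube n -> bool).
Hypothesis n2 : (2 <= n)%N.

Implicit Types (x : cube n) (s : seq 'I_n).

Definition infl x i := f x != f (flip x i).

Lemma total_influenceE :
  total_influence R f = n%:R * avg (fun x => avg (fun i : 'I_n => (infl x i)%:R)).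
Proof.
rewrite /total_influence; congr (_ * _); rewrite avg_pair /avg card_prod card_cube card_ord.
rewrite natrM mulrC; congr (_ * _).
by rewrite -sum1_card natr_sum big_mkcond /=; apply: eq_bigr => x _; rewrite inE /infl; case: (_ != _).
Qed.

Variable (H : cube n -> 'I_n -> bool).
Hypothesis HV : forall x i, H x i -> violating f x (flip x i).
Hypothesis HC : forall x i, H (flip x i) i = H x i.

Definition crossings (P : cube n -> 'I_n -> bool) :=
  fix cr x s := if s is i :: s' then (P x i + cr (flip x i) s')%N else 0%N.

Lemma H_infl x i : H x i -> infl x i.
Proof.
by move/HV; rewrite /violating /infl; case: (f x); case: (f (flip x i)) => //=;
  rewrite ?andbF.
Qed.

Lemma leq_crossings x s : (crossings H x s <= crossings infl x s)%N.
Proof.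
elim: s x => //= i s IH x; apply: leq_add => //.
by have := @H_infl x i; case: (H x i) => //= ->.
Qed.

Lemma walk_cons x i s : walk x (i :: s) = x :: walk (flip x i) s.
Proof. by []. Qed.

Lemma size_walk x s : size (walk x s) = (size s).+1.
Proof. by rewrite /= size_scanl. Qed.

Lemma crossings0 d x s i : crossings infl x s = 0%N -> (i < size s)%N ->
  f (nth d (walk x s) i) = f (nth d (walk x s) i.+1).
Proof.
elim: s x i => // j s IH x i; rewrite walk_cons /= => /eqP; rewrite addn_eq0 => /andP[xj /eqP c].
case: i => [_|i]; last exact: IH.
by move: xj; rewrite eqb0 negbK => /eqP.
Qed.

(** Steps along [H] are influential, so when there is one of each kind they are the same step. *)
Lemma crossings1 d x s i : crossings infl x s = 1%N -> crossings H x s = 1%N ->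
  (i < size s)%N -> f (nth d (walk x s) i) != f (nth d (walk x s) i.+1) ->
  violating f (nth d (walk x s) i) (nth d (walk x s) i.+1).
Proof.
elim: s x i => // j s IH x i; rewrite walk_cons /=.
have := leq_crossings (flip x j) s; have := @H_infl x j.
have [_|e] := boolP (infl x j).
  move=> _ hle; rewrite add1n => -[c0]; move: hle; rewrite c0 leqn0 => /eqP ->; rewrite addn0 => Hj.
  case: i => [_ _|i si]; first by apply: HV; case: (H x j) Hj.
  by move/eqP; case; apply: (crossings0 d c0).
case: (H x j) => [/(_ isT)//|_ _]; rewrite !add0n => c1 h1.
case: i => [_|i]; last exact: IH.
by rewrite /= -[_ != _]/(infl x j) (negPf e).
Qed.

Lemma last_walk_parity x s : f (last x (walk x s)) = f x (+) odd (crossings infl x s).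
Proof.
rewrite /=; elim: s x => /= [|j s IH] x; first by rewrite addbF.
rewrite IH oddD /infl; case: (f x); case: (f (flip x j)) => //=; by case: odd.
Qed.

(** Each midpoint keeps the values at the ends different and strictly shrinks the interval, so the
    fuel lasts until the ends are adjacent. *)
Lemma bsearchP (zs : seq (cube n)) x0 fuel lo hi :
  (lo < hi)%N -> (hi - lo <= fuel)%N -> f (nth x0 zs lo) != f (nth x0 zs hi) ->
  let r := bsearch f zs x0 fuel lo hi in
  (r < hi)%N /\ f (nth x0 zs r) != f (nth x0 zs r.+1).
Proof.
elim: fuel lo hi => [|fuel IH] lo hi lh; first by rewrite leqn0 subn_eq0 leqNgt lh.
move=> lf ne /=; case: (leqP hi lo.+1) => [hl|hl].
  split=> //; by have -> : lo.+1 = hi by apply/eqP; rewrite eqn_leq lh hl.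
have lm : (lo < (lo + hi)./2)%N by rewrite -divn2; lia.
have mh : ((lo + hi)./2 < hi)%N by rewrite -divn2; lia.
case: (f _ =P f _) => [e|/eqP e].
  by apply: IH => //; rewrite ?e //; lia.
have [] := IH lo (lo + hi)./2 lm _ _; first lia.
  by rewrite eq_sym.
by move=> r1 r2; split=> //; apply: ltn_trans mh.
Qed.

Lemma rejects_of_crossings x s :
  crossings infl x s = 1%N -> crossings H x s = 1%N -> rejects f x s.
Proof.
move=> c1 h1; have fxy : f x != f (last x (walk x s)).
  by rewrite last_walk_parity c1 /=; case: (f x).
rewrite /rejects fxy /=.
have s0 : (0 < size s)%N by case: s c1 {h1 fxy}.
have lastE : last x (walk x s) = nth x (walk x s) (size s).
  by rewrite -nth_last size_walk.
have [] := @bsearchP (walk x s) x (size (walk x s)) 0 (size s) s0.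
- by rewrite subn0 size_walk.
- by rewrite -lastE.
by move=> r1 r2; apply: crossings1.
Qed.

(* [h (2 - c)] is positive only for [h = c = 1], when binary search has no choice. *)
Lemma rejects_ge x s :
  (crossings H x s * 2 <= rejects f x s + crossings H x s * crossings infl x s)%N.
Proof.
have := leq_crossings x s; have := @rejects_of_crossings x s.
case: (crossings infl x s) => [|[|c]] H1.
- by rewrite leqn0 => /eqP ->.
- rewrite muln1; case: (crossings H x s) H1 => [|[|h]] //= H1 _.
  by rewrite H1.
- by move=> _; apply: leq_trans (leq_addl _ _); rewrite leq_mul2l orbT.
Qed.

Definition avgx (F : cube n -> 'I_n -> R) : R := avg (fun x => avg (F x)).

Lemma avg_flip (i : 'I_n) (F : cube n -> R) : avg (fun x => F (flip x i)) = avg F.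
Proof. by rewrite [RHS](avg_reindex _ (inv_inj (@flipK _ i))). Qed.

Section Rate.
Variable D : R.
Hypothesis HD : forall x, avg (fun i => (H x i)%:R : R) <= D.
Let eta : R := avgx (fun x i => (H x i)%:R).
Let iota : R := avgx (fun x i => (infl x i)%:R).

(** The uniform distribution is stationary, so every step contributes the same mean. *)
Lemma avg_wavg_crossings P k :
  avg (fun x => wavg k (fun s => (crossings P x s)%:R)) =
  k%:R * avgx (fun x i => (P x i)%:R).
Proof.
have c0 : (0 < #|'I_n|)%N by rewrite card_ord ltnW.
elim: k => [|k IH] /=; first by rewrite mul0r (eq_avg (G := fun=> 0)) ?avg_cst ?cube_gt0.
transitivity (avg (fun x => avg (fun i : 'I_n => (P x i)%:R +
    wavg k (fun s => (crossings P (flip x i) s)%:R)) : R)).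
  apply: eq_avg => x; apply: eq_avg => i.
  rewrite -[X in X + _](wavg_cst k _ c0) -wavgD; apply: eq_wavg => s.
  by rewrite natrD.
under eq_avg do rewrite avgD.
rewrite avgD -/(avgx _) [X in _ + X]avg_exch.
under [X in _ + X]eq_avg do rewrite (avg_flip _ (fun x => wavg k (fun s => (crossings P x s)%:R))).
by rewrite avg_cst // IH -natr1 mulrDl mul1r addrC.
Qed.

(* Generalized over the weight [w], which the induction averages over neighbours. *)
Lemma avg_weight_crossings (w : cube n -> R) k : (forall x, 0 <= w x) ->
  avg (fun x => w x * wavg k (fun s => (crossings H x s)%:R)) <= k%:R * D * avg w.
Proof.
have c0 : (0 < #|'I_n|)%N by rewrite card_ord ltnW.
elim: k w => [|k IH] w w0 /=.
  by rewrite !mul0r (eq_avg (G := fun=> 0)) ?avg_cst ?cube_gt0 // => x; rewrite mulr0.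
have -> : avg (fun x => w x * avg (fun i => wavg k (fun v => (H x i + crossings H (flip x i) v)%:R)))
  = avg (fun x => w x * avg (fun i => (H x i)%:R)) +
    avg (fun x => avg (fun i => w (flip x i)) * wavg k (fun s => (crossings H x s)%:R)) :> R.
  transitivity (avg (fun x => w x * avg (fun i => (H x i)%:R) +
     avg (fun i => w x * wavg k (fun s => (crossings H (flip x i) s)%:R))) : R).
    apply: eq_avg => x; rewrite avgZ -mulrDr -avgD; congr (_ * _); apply: eq_avg => i.
    rewrite -[X in _ = X + _](wavg_cst k _ c0) -wavgD; apply: eq_wavg => s.
    by rewrite natrD.
  rewrite avgD; congr (_ + _); rewrite avg_exch.
  under [RHS]eq_avg do rewrite -avgMr.
  rewrite [RHS]avg_exch; apply: eq_avg => i.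
  rewrite -(avg_flip i (fun x => w x * _)).
  by apply: eq_avg => x; rewrite flipK.
have -> : k.+1%:R * D * avg w = D * avg w + k%:R * D * avg w by rewrite -natr1; ring.
apply: lerD.
  by rewrite -avgZ; apply: avg_le => x; rewrite mulrC; apply: ler_wpM2r.
have -> : avg w = avg (fun x => avg (fun i => w (flip x i))).
  by rewrite avg_exch; under [RHS]eq_avg => i do rewrite /= (avg_flip i w); rewrite avg_cst.
by apply: IH => x; apply: avg_ge0.
Qed.

Lemma avg_edge_shift (P : cube n -> 'I_n -> bool) (w : cube n -> R) :
  (forall x i, P (flip x i) i = P x i) ->
  avg (fun x => avg (fun i => (P x i)%:R * w (flip x i))) =
  avg (fun x => avg (fun i => (P x i)%:R) * w x).
Proof.
move=> PC; under [RHS]eq_avg do rewrite -avgMr.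
rewrite [LHS]avg_exch [RHS]avg_exch; apply: eq_avg => i.
rewrite -(avg_flip i (fun x => _ * w x)).
by apply: eq_avg => x; rewrite PC.
Qed.

(** Splitting off the first step gives [eta] where both counts use it, the same quantity for the
    shorter walk, and two mixed terms of at most [k D iota] each, matching
    [k (k - 1) + 2 k = (k + 1) k]. *)
Lemma avg_crossings2 k :
  avg (fun x => wavg k (fun s => (crossings H x s)%:R * (crossings infl x s)%:R))
    <= k%:R * eta + k%:R * (k%:R - 1) * D * iota.
Proof.
have c0 : (0 < #|'I_n|)%N by rewrite card_ord ltnW.
have inflC x i : infl (flip x i) i = infl x i by rewrite /infl flipK eq_sym.
elim: k => [|k IH] /=.
  by rewrite !mul0r addr0 (eq_avg (G := fun=> 0)) ?avg_cst ?cube_gt0 // => x; rewrite mul0r.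
pose h x := wavg k (fun s => (crossings H x s)%:R : R).
pose c x := wavg k (fun s => (crossings infl x s)%:R : R).
set T4 := avg _ in IH.
have -> : avg (fun x => avg (fun i => wavg k (fun v =>
    (H x i + crossings H (flip x i) v)%:R * (infl x i + crossings infl (flip x i) v)%:R)))
  = eta + avg (fun x => avg (fun i => (H x i)%:R) * c x)
    + avg (fun x => avg (fun i => (infl x i)%:R) * h x) + T4.
  rewrite -(avg_edge_shift c HC) -(avg_edge_shift h inflC).
  have <- : avg (fun x => avg (fun i => wavg k (fun s =>
     (crossings H (flip x i) s)%:R * (crossings infl (flip x i) s)%:R))) = T4.
    rewrite avg_exch -[RHS](avg_cst _ c0); apply: eq_avg => i.
    exact: (avg_flip i (fun x => wavg k (fun s => (crossings H x s)%:R * (crossings infl x s)%:R))).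
  rewrite /eta /avgx -!avgD; apply: eq_avg => x; rewrite -!avgD; apply: eq_avg => i.
  rewrite -[X in X + _ + _ + _](wavg_cst k _ c0) -!wavgZ -!wavgD; apply: eq_wavg => s.
  have HI : (H x i)%:R * (infl x i)%:R = (H x i)%:R :> R.
    by have := @H_infl x i; case: (H x i) => [/(_ isT) ->|_]; rewrite ?mulr1 ?mul0r.
  rewrite !natrD mulrDl !mulrDr HI; ring.
have cE : avg c = k%:R * iota by apply: avg_wavg_crossings.
have cg x : 0 <= c x.
  by rewrite -[0](wavg_cst k 0 c0); apply: wavg_le.
have T2 : avg (fun x => avg (fun i => (H x i)%:R) * c x) <= D * (k%:R * iota).
  by rewrite -cE -avgZ; apply: avg_le => x; apply: ler_wpM2r.
have T3 : avg (fun x => avg (fun i => (infl x i)%:R) * h x) <= k%:R * D * iota.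
  by apply: avg_weight_crossings => x; apply: avg_ge0.
rewrite -natr1; move: IH T2 T3; move: (avg _) (avg _) T4 => a b T4.
nra.
Qed.

Lemma avg_rejects_ge k :
  k%:R * (eta - (k%:R - 1) * D * iota) <= avg (fun x => wavg k (fun s => (rejects f x s)%:R)).
Proof.
apply: (@le_trans _ _ (avg (fun x => wavg k (fun s => 2 * (crossings H x s)%:R +
    -1 * ((crossings H x s)%:R * (crossings infl x s)%:R))))).
  have -> : avg (fun x => wavg k (fun s => 2 * (crossings H x s)%:R +
    -1 * ((crossings H x s)%:R * (crossings infl x s)%:R))) =
    2 * (k%:R * eta) - avg (fun x => wavg k (fun s =>
      (crossings H x s)%:R * (crossings infl x s)%:R)).
    have <- : avg (fun x => wavg k (fun s => (crossings H x s)%:R)) = k%:R * eta.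
      exact: avg_wavg_crossings.
    rewrite -avgZ -[X in _ = _ + X]mulN1r -avgZ -avgD; apply: eq_avg => x.
    by rewrite wavgD !wavgZ.
  have := avg_crossings2 k; lra.
apply: avg_le => x; apply: wavg_le => s _.
by have := rejects_ge x s; rewrite -(ler_nat R) natrD !natrM; lra.
Qed.

End Rate.
End Walks.

(** * Maximal graphs of violating edges of bounded degree *)

Section Greedy.
Variables (R : realType) (n : nat) (f : cube n -> bool).
Implicit Types (x y : cube n) (i j l : 'I_n).

Definition viol x i := violating f x (flip x i).

Lemma viol_flip x i : viol (flip x i) i = viol x i.
Proof. by rewrite /viol flipK /violating orbC. Qed.

Definition nbrs (E : {set cube n * 'I_n}) x := [set i | (x, i) \in E].

(** An undirected edge is stored as the two pairs based at its endpoints, hence the symmetry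
    requirement. *)
Definition bounded_subgraph d (E : {set cube n * 'I_n}) :=
  [forall x, (#|nbrs E x| <= d)%N &&
    [forall i, ((x, i) \in E) ==> viol x i && ((flip x i, i) \in E)]].

Lemma bounded_subgraph0 d : bounded_subgraph d set0.
Proof.
apply/forallP => x; apply/andP; split; last by apply/forallP => i; rewrite inE.
by rewrite (_ : nbrs set0 x = set0) ?cards0 //; apply/setP => i; rewrite !inE.
Qed.

Definition greedy d : {set cube n * 'I_n} :=
  s2val (maxset_exists (bounded_subgraph0 d)).

Lemma greedy_bounded d : bounded_subgraph d (greedy d).
Proof. by rewrite /greedy; case: maxset_exists => E /= /maxsetp. Qed.

Lemma greedy_card d x : (#|nbrs (greedy d) x| <= d)%N.
Proof. by have /forallP/(_ x)/andP[] := greedy_bounded d. Qed.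

Lemma greedy_viol d x i : (x, i) \in greedy d -> viol x i.
Proof. by have /forallP/(_ x)/andP[_ /forallP/(_ i)/implyP H] := greedy_bounded d => /H/andP[]. Qed.

Lemma greedy_flip d x i : ((flip x i, i) \in greedy d) = ((x, i) \in greedy d).
Proof.
have G y : (y, i) \in greedy d -> (flip y i, i) \in greedy d.
  by have /forallP/(_ y)/andP[_ /forallP/(_ i)/implyP H] := greedy_bounded d => /H/andP[].
by apply/idP/idP => /G //; rewrite flipK.
Qed.

(** Adding both orientations of the edge raises only the degrees of its two endpoints, by at most 1,
    so by maximality the edge was already there. *)
Lemma greedy_max d x i : viol x i ->
  (#|nbrs (greedy d) x| < d)%N -> (#|nbrs (greedy d) (flip x i)| < d)%N ->
  (x, i) \in greedy d.
Proof.
move=> vxi dx dy; set E := greedy d in dx dy *.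
pose E' := (x, i) |: ((flip x i, i) |: E).
suff <- : E' = E by rewrite !inE eqxx.
have mE : maxset (bounded_subgraph d) E by rewrite /E /greedy; case: maxset_exists.
apply: (maxsetsup mE); last by apply/subsetP => p pE; rewrite !inE pE !orbT.
have fx : (flip x i == x) = false.
  by apply/eqP => /ffunP/(_ i); rewrite flip_same; case: (x i).
apply/forallP => y; apply/andP; split.
  have sub z : (#|nbrs E z| < d)%N -> nbrs E' z \subset i |: nbrs E z -> (#|nbrs E' z| <= d)%N.
    move=> zd /subset_leq_card zs; apply: leq_trans zs _; rewrite cardsU1.
    by apply: leq_trans zd; case: (_ \notin _).
  have [->|yx] := eqVneq y x.
    apply: sub => //; apply/subsetP => j; rewrite !inE !xpair_eqE.
    by case: (j == i); rewrite ?orbT // !andbF.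
  have [->|yf] := eqVneq y (flip x i).
    apply: sub => //; apply/subsetP => j; rewrite !inE !xpair_eqE.
    by case: (j == i); rewrite ?orbT // !andbF.
  rewrite (_ : nbrs E' y = nbrs E y) ?greedy_card //; apply/setP => j.
  by rewrite !inE !xpair_eqE (negPf yx) (negPf yf).
apply/forallP => j; apply/implyP; rewrite !inE => /or3P[/eqP[-> ->]|/eqP[-> ->]|yE].
- by rewrite vxi eqxx orbT.
- by rewrite viol_flip vxi flipK eqxx.
- by rewrite (greedy_viol yE) greedy_flip yE !orbT.
Qed.

Variable J : nat.
Hypothesis nJ : (n <= 2 ^ J)%N.
Hypothesis J0 : (0 < J)%N.

Definition saturated r x := (2 ^ r <= #|nbrs (greedy (2 ^ r)) x|)%N.
(* Violating edges are oriented towards the endpoint of larger rank (both ways in case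
   of a tie); an edge whose endpoints have rank at most [r] lies in the graph of scale [r]. *)
Definition rank x := \max_(r < J | saturated r x) r.+1.

Lemma rank_le x : (rank x <= J)%N.
Proof. by apply/bigmax_leqP => r _. Qed.

Lemma rank_unsaturated x r : (r < J)%N -> (rank x <= r)%N -> ~~ saturated r x.
Proof.
move=> rJ; apply: contraL => sr; rewrite -ltnNge.
exact: (@leq_bigmax_cond _ (fun r : 'I_J => saturated r x) (fun r => r.+1) (Ordinal rJ)).
Qed.

Lemma rank_saturated x : rank x = 0%N \/ exists2 r, (r < J)%N & saturated r x /\ rank x = r.+1.
Proof.
have [->|] := posnP (rank x); first by left.
rewrite {1}/rank => r0; right.
have [r sr] : exists r : 'I_J, saturated r x.
  apply/existsP; apply: contraLR r0; rewrite negb_exists => /forallP ns.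
  by rewrite big_pred0 // => r; apply/negbTE.
have c0 : (0 < #|[pred r : 'I_J | saturated r x]|)%N by apply/card_gt0P; exists r.
by have [q sq qE] := eq_bigmax_cond (fun r : 'I_J => r.+1) c0; exists q.
Qed.

Definition mark l x := viol x l && (rank (flip x l) <= rank x)%N.

Lemma mark_covers l : covers l f (mark l).
Proof.
move=> x xl fx fy; have v : viol x l.
  rewrite /viol /violating fx fy !andbT; apply/orP; left.
  by apply/forallP => j; rewrite ffunE; case: eqP => [->|_]; rewrite ?implybb // (negPf xl).
by rewrite /mark viol_flip v flipK /=; apply: leq_total.
Qed.

Lemma mark_greedy l x : (rank x < J)%N -> mark l x -> (x, l) \in greedy (2 ^ rank x).
Proof.
move=> rJ /andP[v rl]; apply: greedy_max => //; rewrite ltnNge; apply: rank_unsaturated => //.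
Qed.

Definition mean_degree r : R := avg (fun x => #|nbrs (greedy (2 ^ r)) x|%:R).

Lemma card_marks x : \sum_l (mark l x)%:R = #|[set l | mark l x]|%:R :> R.
Proof.
by rewrite -sum1_card natr_sum [RHS]big_mkcond; apply: eq_bigr => l _; rewrite inE; case: (mark _ _).
Qed.

(** At rank 0 the marked edges lie in the graph of scale 0, and [sqrt d <= d] for integers. At rank
    [r + 1] there are at most [2 ^ (r + 1)] marks, while saturation gives degree at least [2 ^ r] at
    scale [r]. *)
Lemma sqrt_marks_le x : Num.sqrt (\sum_l (mark l x)%:R : R) <=
  #|nbrs (greedy (2 ^ 0)) x|%:R
  + \sum_(r < J) 2 / Num.sqrt (2 ^ r)%:R * #|nbrs (greedy (2 ^ r)) x|%:R.
Proof.
have T0 (r : nat) : 0 <= 2 / Num.sqrt (2 ^ r)%:R * #|nbrs (greedy (2 ^ r)) x|%:R :> R.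
  by rewrite mulr_ge0 // divr_ge0 // sqrtr_ge0.
rewrite card_marks.
have sub : (rank x < J)%N -> (#|[set l | mark l x]| <= #|nbrs (greedy (2 ^ rank x)) x|)%N.
  move=> rJ; apply: subset_leq_card; apply/subsetP => l; rewrite !inE; exact: mark_greedy.
have [r0|[r rJ [sr rE]]] := rank_saturated x.
  rewrite r0 in sub; rewrite -[leLHS]addr0; apply: lerD; last by apply: sumr_ge0.
  apply: le_trans (_ : Num.sqrt #|nbrs (greedy (2 ^ 0)) x|%:R <= _).
    by apply: ler_wsqrtr; rewrite ler_nat sub.
  case: #|_| => [|d]; first by rewrite sqrtr0.
  rewrite -[leRHS]ger0_norm // -sqrtr_sqr; apply: ler_wsqrtr.
  by rewrite expr2 -[leLHS]mulr1; apply: ler_wpM2l; rewrite // ler1n.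
rewrite -[leLHS]add0r; apply: lerD => //.
rewrite (bigD1 (Ordinal rJ)) //= -[leLHS]addr0; apply: lerD; last by apply: sumr_ge0.
set s : R := Num.sqrt (2 ^ r)%:R.
have s0 : 0 < s by rewrite sqrtr_gt0 ltr0n expn_gt0.
have s2 : s ^+ 2 = (2 ^ r)%:R by rewrite sqr_sqrtr.
(* At the top rank [J] the bound is the trivial one, from [n <= 2 ^ J]; below it, the marks lie in
   the graph of the next scale. *)
have Dle : (#|[set l | mark l x]| <= 2 ^ r.+1)%N.
  rewrite -rE; have := rank_le x; rewrite leq_eqVlt => /orP[/eqP ->|/sub H].
    by apply: leq_trans (max_card _) _; rewrite card_ord.
  by apply: leq_trans H (greedy_card _ _).
apply: (@le_trans _ _ (2 * s)).
  have -> : 2 * s = Num.sqrt ((2 * s) ^+ 2) by rewrite sqrtr_sqr ger0_norm // mulr_ge0 // ltW.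
  apply: ler_wsqrtr; rewrite exprMn s2; apply: (@le_trans _ _ (2 ^ r.+1)%:R); first by rewrite ler_nat.
  rewrite expnS natrM; have := ler0n R (2 ^ r); rewrite expr2; lra.
have : s ^+ 2 <= #|nbrs (greedy (2 ^ r)) x|%:R by rewrite s2 ler_nat.
move=> H; rewrite -mulrA; apply: ler_wpM2l => //.
by rewrite ler_pdivlMl.
Qed.

(** If every scale failed, averaging [sqrt_marks_le] would bound [phi] strictly by [T + 2 J T],
    which is at most [3 J T = phi]. *)
Lemma exists_dense : exists2 r, (r < J)%N &
  phi R mark / (3 * J%:R) * Num.sqrt (2 ^ r)%:R <= mean_degree r.
Proof.
set T := phi R mark / _.
have J0' : 1 <= J%:R :> R by rewrite ler1n.
have T0 : 0 <= T by rewrite divr_ge0 ?phi_ge0 // mulr_ge0.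
have [/existsP[r]|] := boolP [exists r : 'I_J, T * Num.sqrt (2 ^ r)%:R <= mean_degree r].
  by exists r.
rewrite negb_exists => /forallP H; exfalso.
have s0 (r : nat) : 0 < Num.sqrt (2 ^ r)%:R :> R by rewrite sqrtr_gt0 ltr0n expn_gt0.
have : phi R mark <= mean_degree 0 + \sum_(r < J) 2 / Num.sqrt (2 ^ r)%:R * mean_degree r.
  apply: le_trans (avg_le sqrt_marks_le) _; rewrite avgD; apply: lerD => //.
  by rewrite avg_sum; apply: ler_sum => r _; rewrite avgZ.
have : \sum_(r < J) 2 / Num.sqrt (2 ^ r)%:R * mean_degree r <= \sum_(r < J) 2 * T.
  apply: ler_sum => r _; rewrite -mulrA; apply: ler_wpM2l => //.
  by rewrite ler_pdivrMl // mulrC ltW // ltNge.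
rewrite sumr_const card_ord -[X in _ <= X]mulr_natr.
have mu0 : mean_degree 0 < T.
  have := H (Ordinal J0); rewrite -ltNge /= expn0 sqrtr1 mulr1; exact.
have -> : phi R mark = T * (3 * J%:R).
  by rewrite /T mulfVK // gt_eqF // mulr_gt0 // ltr0n.
have TJ : T <= T * J%:R by rewrite ler_peMr.
lra.
Qed.

End Greedy.

(** * Choice of the walk length *)

Section Sampling.
Variables (R : realType) (n : nat) (f : cube n -> bool).
Hypothesis n2 : (2 <= n)%N.

Lemma wavg_tuple (J : finType) k (F : seq J -> R) : (0 < #|J|)%N ->
  wavg k F = avg (fun t : k.-tuple J => F t).
Proof.
move=> J0; rewrite -[in LHS](size_enum_ord k) -avg_word ?enum_uniq // /avg.
rewrite card_ffun card_tuple card_ord; congr (_ * _).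
rewrite [RHS](reindex (fun w : {ffun 'I_k -> J} => [tuple w i | i < k])) //=.
exists (fun t : k.-tuple J => [ffun i => tnth t i]) => [w|t] _.
  by apply/ffunP => i; rewrite ffunE tnth_mktuple.
by apply: eq_from_tnth => i; rewrite tnth_mktuple ffunE.
Qed.

Definition reject_rate l : R := avg (fun x => wavg l (fun s => (rejects f x s)%:R)).

Lemma reject_rate_ge0 l : 0 <= reject_rate l.
Proof.
apply: avg_ge0 => x; rewrite wavg_tuple ?card_ord 1?ltnW //.
exact: avg_ge0.
Qed.

Lemma reject_probE : reject_prob R f =
  (Kmax n).+1%:R^-1 * \sum_(k < (Kmax n).+1) reject_rate (2 ^ k).
Proof.
congr (_ * _); apply: eq_bigr => k _; rewrite /reject_rate.
under eq_avg do rewrite wavg_tuple ?card_ord 1?ltnW //.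
rewrite avg_pair /avg card_prod card_cube card_tuple card_ord natrM mulrC; congr (_ * _).
by rewrite -sum1_card natr_sum big_mkcond /=; apply: eq_bigr => p _; rewrite inE; case: rejects.
Qed.

(** The exponent 0 always qualifies because [2 ^ 0 - 1 = 0]; the search stops at the first failure
    or at [K]. *)
Lemma last_good_power (a b : R) K : 0 <= b ->
  exists2 k, (k <= K)%N & ((2 ^ k)%:R - 1) * a <= b /\ (k = K \/ b < ((2 ^ k.+1)%:R - 1) * a).
Proof.
move=> b0; elim: K => [|K [k kK [le lt]]].
  by exists 0%N => //; rewrite expn0 subrr mul0r; split=> //; left.
case: lt => [kE|lt]; last by exists k; [rewrite leqW|split=> //; right].
have [le'|lt'] := leP (((2 ^ K.+1)%:R - 1) * a) b.
  by exists K.+1 => //; split=> //; left.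
by exists k; [rewrite leqW|split=> //; right; rewrite kE].
Qed.

Lemma reject_prob_ge (d : R) (H : cube n -> 'I_n -> bool)
  (mean_degree := avg (fun x => \sum_i (H x i)%:R)) :
  (forall x i, H x i -> violating f x (flip x i)) ->
  (forall x i, H (flip x i) i = H x i) ->
  1 <= d -> (forall x, \sum_i (H x i)%:R <= d) -> 0 < mean_degree ->
  mean_degree ^+ 2 / (8 * d * total_influence R f * (Kmax n).+1%:R) <= reject_prob R f.
Proof.
move=> HV HC d1 Hd mu0.
have N0 : 0 < n%:R :> R by rewrite ltr0n ltnW.
pose eta := avgx (fun x i => (H x i)%:R : R).
pose io := avgx (fun x i => (infl f x i)%:R : R).
have etaE : mean_degree = n%:R * eta.
  rewrite /eta /avgx -avgZ; apply: eq_avg => x.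
  by rewrite /avg card_ord mulVKf // gt_eqF.
have IE : total_influence R f = n%:R * io by apply: total_influenceE.
have eta0 : 0 < eta by rewrite -(pmulr_rgt0 _ N0) -etaE.
have eta_io : eta <= io.
  apply: avg_le => x; apply: avg_le => i; rewrite ler_nat.
  by have := H_infl HV (x := x) (i := i); case: (H x i) => [/(_ isT) ->|].
have io0 : 0 < io by apply: lt_le_trans eta_io.
have HD x : avg (fun i => (H x i)%:R : R) <= d / n%:R.
  rewrite /avg card_ord mulrC; apply: ler_wpM2r; [by rewrite invr_ge0 ltW | exact: Hd].
set D := d / n%:R in HD; have D0 : 0 < D by rewrite divr_gt0 // (lt_le_trans _ d1).
have dE : d = n%:R * D by rewrite mulrC /D divfK // gt_eqF.
have [|k kK [le lt]] := @last_good_power (D * io) (eta / 2) (Kmax n); first by lra.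
have := avg_rejects_ge n2 HV HC HD (2 ^ k); rewrite -/eta -/io -/(reject_rate _).
set l : R := (2 ^ k)%:R in le *; have l0 : 0 < l by rewrite ltr0n expn_gt0.
move=> rate.
have rate2 : l * (eta / 2) <= reject_rate (2 ^ k).
  apply: le_trans rate; rewrite ler_pM2l // -mulrA; lra.
(* The length is not too short. If the next power fails, [2 l D io] exceeds [eta / 2]; if the
   exponent is the last one, [l >= n] and [d >= 1] give [D l >= 1], and [eta <= io] suffices. *)
have key : eta <= 4 * (D * io) * l.
  case: lt => [kE|lt].
    have Nl : n%:R <= l by rewrite /l kE ler_nat up_logP.
    have Dl : 1 <= D * l.
      by apply: le_trans d1 _; rewrite dE mulrC ler_pM2l.
    have -> : 4 * (D * io) * l = 4 * io * (D * l) by ring.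
    have : 4 * io <= 4 * io * (D * l) by rewrite ler_peMr // mulr_ge0 // ltW.
    lra.
  have e2 : (2 ^ k.+1)%:R = 2 * l by rewrite expnS natrM.
  rewrite e2 in lt; have := mulr_gt0 D0 io0; lra.
rewrite reject_probE; apply: (@le_trans _ _ ((Kmax n).+1%:R^-1 * (l * (eta / 2)))).
  rewrite etaE IE [X in 8 * X * _ * _]dE.
  have J0 : (Kmax n).+1%:R != 0 :> R by rewrite pnatr_eq0.
  have -> : (n%:R * eta) ^+ 2 / (8 * (n%:R * D) * (n%:R * io) * (Kmax n).+1%:R)
     = (Kmax n).+1%:R^-1 * (eta * (eta / (8 * (D * io)))).
    by field; rewrite nat1r J0 !gt_eqF.
  apply: ler_wpM2l; first by rewrite invr_ge0.
  rewrite [leRHS]mulrCA; apply: ler_wpM2l; first exact: ltW.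
  rewrite ler_pdivrMr; last by rewrite pmulr_rgt0 // (mulr_gt0 D0 io0).
  have -> : l / 2 * (8 * (D * io)) = 4 * (D * io) * l by field.
  exact: key.
apply: ler_wpM2l; first by rewrite invr_ge0.
have kJ : (k < (Kmax n).+1)%N by rewrite ltnS.
rewrite (bigD1 (Ordinal kJ)) //= -[leLHS]addr0; apply: lerD => //.
by apply: sumr_ge0 => i _; apply: reject_rate_ge0.
Qed.

End Sampling.

(** * Logarithms and the final constants *)

Lemma log2_ge1 (R : realType) n : (2 <= n)%N -> 1 <= log2 (n%:R : R).
Proof.
move=> n2; have l2 : 0 < ln 2 :> R by rewrite ln_gt0 // ltr1n.
by rewrite /log2 ler_pdivlMr // mul1r ler_ln ?posrE ?ltr0n ?ler_nat // ltnW.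
Qed.

Lemma Kmax_le_log2 (R : realType) n : (2 <= n)%N -> (Kmax n).+1%:R <= 3 * log2 (n%:R : R).
Proof.
move=> n2; have l2 : 0 < ln 2 :> R by rewrite ln_gt0 // ltr1n.
have n0 : 0 < n%:R :> R by rewrite ltr0n ltnW.
have L1 := log2_ge1 R n2.
suff : (Kmax n).-1%:R <= log2 (n%:R : R).
  case: (Kmax n) => [|k] /=; first by lra.
  rewrite -2!natr1; lra.
rewrite /log2 ler_pdivlMr // mulr_natl -lnXn // ler_ln ?posrE ?exprn_gt0 //.
have /andP[/ltnW H _] := @up_log_bounds 2 n isT n2.
by rewrite -natrX ler_nat.
Qed.

Theorem theorem3p1 (R : realType) :
  exists c : R, 0 < c /\
  forall (n : nat) (f : cube n -> bool) (eps : R),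
    (2 <= n)%N ->
    total_influence R f <= 6 * Num.sqrt (n%:R) ->
    0 < eps -> eps < 1 ->
    far_from_monotone eps f ->
    c * (eps ^+ 4 / (total_influence R f * (log2 (n%:R : R)) ^+ 9))
      <= reject_prob R f.
Proof.
(* Here [72 = 8 * 3^2] joins the rate bound with [exists_dense], [192 = 2 * 96] comes from the two
   drift bounds, and [81 = 3^4] from [J <= 3 * log2 n]. *)
exists (72 * 192 ^+ 2 * 81)^-1; split=> [|n f eps n2 _ e0 e1 far].
  by rewrite invr_gt0 !mulr_gt0 ?exprn_gt0.
set J := (Kmax n).+1; have nJ : (n <= 2 ^ J)%N.
  apply: leq_trans (up_logP n (isT : (1 < 2)%N)) _.
  by rewrite leq_exp2l.
have N0 : 0 < n%:R :> R by rewrite ltr0n ltnW.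
have J0 : 0 < J%:R :> R by rewrite ltr0n.
have [r rJ] := @exists_dense R n f J nJ isT; set F := phi R _ => dense.
(* The word has length [n * J], so [m/n = J] and the two bounds on the drift give
   [eps / 2 <= 96 * sqrt J * F]. *)
have := le_trans (drift_ge n2 (ltW e0) far) (drift_le R (@mark_covers n f J) (ltnW n2) _).
rewrite -/J -/F natrM mulrAC mulfV ?gt_eqF // mul1r => drift.
set q := Num.sqrt J%:R in drift; have q0 : 0 < q by rewrite sqrtr_gt0.
have q2 : q ^+ 2 = J%:R by rewrite sqr_sqrtr // ltW.
set s := Num.sqrt _ in dense; have s0 : 0 < s by rewrite sqrtr_gt0 ltr0n expn_gt0.
have s2 : s ^+ 2 = (2 ^ r)%:R by rewrite sqr_sqrtr.
pose H x i := (x, i) \in greedy f (2 ^ r).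
have HE x : \sum_i (H x i)%:R = #|nbrs (greedy f (2 ^ r)) x|%:R :> R.
  by rewrite -sum1_card natr_sum [RHS]big_mkcond; apply: eq_bigr => i _; rewrite inE /H; case: (_ \in _).
have muE : avg (fun x => \sum_i (H x i)%:R) = mean_degree R f r by apply: eq_avg => x; apply: HE.
have F0 : 0 < F.
  rewrite ltNge; apply/negP => F0; have : q * F <= 0 by rewrite pmulr_rle0.
  lra.
have mu0 : 0 < mean_degree R f r.
  by apply: lt_le_trans dense; rewrite mulr_gt0 // divr_gt0 // mulr_gt0.
have := @reject_prob_ge R n f n2 (2 ^ r)%:R H.
rewrite muE => /(_ (@greedy_viol _ _ _) (@greedy_flip _ _ _)).
have c1 : 1 <= (2 ^ r)%:R :> R by rewrite ler1n expn_gt0.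
move=> /(_ c1 _ mu0); have Hd x : \sum_i (H x i)%:R <= (2 ^ r)%:R :> R.
  by rewrite HE ler_nat greedy_card.
move=> /(_ Hd); apply: le_trans.
set L := log2 _; have JL : J%:R <= 3 * L by apply: Kmax_le_log2.
have L1 : 1 <= L by apply: log2_ge1.
set I := total_influence R f; have [I0|I0] := eqVneq I 0.
  (* Division by zero returns 0, so both sides vanish. *)
  by rewrite I0 mul0r invr0 !mulr0 mul0r invr0 mulr0.
have {I0}I0 : 0 < I.
  by rewrite lt0r I0 mulr_ge0 // divr_ge0 // mulr_ge0.
clearbody I F L; have L0 : 0 < L by apply: lt_le_trans L1.
have frac (x y a b : R) : 0 <= x -> x <= y -> 0 < b -> b <= a -> x / a <= y / b.
  move=> x0 xy b0 ba; apply: ler_pM; rewrite ?invr_ge0 ?(ltW (lt_le_trans b0 ba)) //.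
  by rewrite lef_pV2 ?posrE // (lt_le_trans b0).
(* The factor [2 ^ r] cancels between the squared mean degree and the maximal degree. What remains
   is weakened by [eps ^+ 4 <= eps ^+ 2] and [L ^+ 4 <= L ^+ 9]. *)
apply: (@le_trans _ _ ((q * F) ^+ 2 / (72 * I * J%:R ^+ 4))); last first.
  have -> : (q * F) ^+ 2 / (72 * I * J%:R ^+ 4)
      = (F / (3 * J%:R) * s) ^+ 2 / (8 * (2 ^ r)%:R * I * J%:R).
    by rewrite -s2 -q2; field; rewrite !gt_eqF.
  apply: frac; rewrite ?sqr_ge0 ?mulr_gt0 // ?ltr0n ?expn_gt0 //.
  by apply: lerXn2r; rewrite ?nnegrE ?(ltW mu0) // mulr_ge0 ?divr_ge0 ?mulr_ge0 ?ltW.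
have -> : (72 * 192 ^+ 2 * 81)^-1 * (eps ^+ 4 / (I * L ^+ 9))
    = (eps ^+ 4 / 192 ^+ 2) / (72 * I * (81 * L ^+ 9)).
  by field; rewrite !gt_eqF.
apply: frac.
- by rewrite divr_ge0 ?exprn_ge0 // ltW.
- have H1 : eps ^+ 4 <= eps ^+ 2 by apply: ler_wiXn2l => //; apply: ltW.
  have H2 : (eps / 192) ^+ 2 <= (q * F) ^+ 2.
    apply: lerXn2r; first by rewrite nnegrE divr_ge0 // ltW.
      by rewrite nnegrE mulr_ge0 // ltW.
    lra.
  apply: le_trans H2; rewrite expr_div_n; apply: ler_wpM2r => //.
  by rewrite invr_ge0 exprn_ge0.
- by rewrite !mulr_gt0 // exprn_gt0.
- apply: ler_wpM2l; first by rewrite mulr_ge0 // ltW.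
  apply: (@le_trans _ _ ((3 * L) ^+ 4)).
    by apply: lerXn2r; rewrite ?nnegrE //; apply: ltW; rewrite mulr_gt0.
  have -> : (3 * L) ^+ 4 = 81 * L ^+ 4 by ring.
  by apply: ler_wpM2l => //; apply: ler_weXn2l.
Qed.
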